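(* Let $\ddot H=\overset{N=4}{\ddot H}(\Lambda^{(2)(1,0)(\mathrm I)}_{0,0})$, the non-irreducible N=4 superconformal module of central charge $-9$ obtained with $M=2$, $m=1$, $m_2=0$, $k_1=k_2=0$. For $\mathrm{Im}\,\tau>0$ and $-\frac12\mathrm{Im}\,\tau<\mathrm{Im}\,z<0$: 1) $\displaystyle\mathrm{ch}^{(+)}_{\ddot H}(\tau,z)=\frac{e^{-2\pi iz}}{\eta(\tau)^3}\sum_{n\in\mathbf Z}e^{2\pi inz}\Big[\sum_{\substack{j,k\in\mathbf Z\\ j,k\ge0}}-\sum_{\substack{j,k\in\mathbf Z\\ j,k<0}}\Big](-1)^j\,q^{\frac12j(j+1)+jk+\frac12(n+2k)^2}$; 2) $\displaystyle\mathrm{ch}^{(+)\mathrm{tw}}_{\ddot H}(\tau,z)=\frac{e^{-\pi iz}}{\eta(\tau)^3}\sum_{n\in\mathbf Z}e^{2\pi inz}\Big[\sum_{\substack{j,k\in\mathbf Z\\ j,k\ge0}}-\sum_{\substack{j,k\in\mathbf Z\\ j,k<0}}\Big](-1)^j\,q^{\frac12j(j+1)+jk+\frac12(n+2k+\frac12)^2}$.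
   Context: $q=e^{2\pi i\tau}$, $q^a=e^{2\pi ia\tau}$; $\vartheta_{ab}(\tau,z)=\sum_{n\in\mathbf Z}e^{\pi i(n+\frac a2)^2\tau+2\pi i(n+\frac a2)(z+\frac b2)}$ (Mumford), $\eta(\tau)=q^{1/24}\prod_{n\ge1}(1-q^n)$. Affine superalgebra. $\widehat A(1,1)$ is the affine Lie superalgebra of $sl(2|2)/\mathbf CI$ with simple roots $\alpha_0,\alpha_2$ (even), $\alpha_1,\alpha_3$ (odd), and $(\alpha_0|\alpha_0)=2$, $(\alpha_2|\alpha_2)=-2$, $(\alpha_1|\alpha_1)=(\alpha_3|\alpha_3)=(\alpha_1|\alpha_3)=(\alpha_0|\alpha_2)=0$, $(\alpha_0|\alpha_1)=(\alpha_0|\alpha_3)=-1$, $(\alpha_1|\alpha_2)=(\alpha_2|\alpha_3)=1$ (so $\alpha_1,\alpha_3$ coincide as functions on the Cartan subalgebra). $\delta=\sum_{i=0}^3\alpha_i$, $\theta=\alpha_1+\alpha_2+\alpha_3$, $(\Lambda_0|\alpha_j)=\delta_{j,0}$, $(\Lambda_0|\Lambda_0)=0$, $\rho=-\frac12(\alpha_1+\alpha_3)$, dual Coxeter number $0$. The Cartan subalgebra is identified with its dual via $(\cdot|\cdot)$, with coordinates $(\tau,z_1,z_2,t)=2\pi i(-\tau\Lambda_0+z+t\delta)$, $z=-\frac{z_1-z_2}2(\alpha_1+\alpha_3)-z_1\alpha_2$; thus $e^{-\alpha_1}=e^{-\alpha_3}=e^{2\pi iz_1}$, $e^{-\alpha_2}=e^{-2\pi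 i(z_1+z_2)}$, $e^{\Lambda_0}=e^{2\pi it}$, $e^{-\delta}=q$. Put $t_\alpha(\lambda)=\lambda+(\lambda|\delta)\alpha-\{\frac{(\alpha|\alpha)}2(\lambda|\delta)+(\lambda|\alpha)\}\delta$, $r_\theta(\lambda)=\lambda-(\lambda|\theta)\theta$, $r_{\alpha_2}(\lambda)=\lambda+(\lambda|\alpha_2)\alpha_2$, and $w.\lambda=w(\lambda+\rho)-\rho$. Characters of modules. All characters are normalized (super)characters ($+$: character, $-$: supercharacter), $\widehat R^{(\pm)}$ is the (super)denominator, and ''numerator'' means the product $\widehat R^{(\pm)}\mathrm{ch}^{(\pm)}$. They are given by the following formulas. For $0\le m_2\le m$ let $\Lambda^{(m,m_2)}=m\Lambda_0+\frac{m_2}2(\alpha_1+\alpha_3)$ and $F^{(\pm)}=\sum_{j\in\mathbf Z}t_{j\theta}\Big(\frac{e^{\Lambda^{(m,m_2)}+\rho}}{(1\pm e^{-\alpha_1})(1\pm e^{-\alpha_3})}\Big)$; then $\widehat R^{(\pm)}\mathrm{ch}^{(\pm)}_{L(\Lambda^{(m,m_2)})}=F^{(\pm)}-r_\theta F^{(\pm)}$. For integers $k_1,k_2\ge0$ with $2k_1+k_2\le M-1$ (type I) put $\beta=-\frac{2k_1+k_2}2(\alpha_1+\alpha_3)-k_1\alpha_2$. The principal admissible weight is $\Lambda^{(M)(m,m_2)(\mathrm I)}_{k_1,k_2}=t_\beta.(\Lambda^{(m,m_2)}-(M-1)\frac mM\Lambda_0)$ and its irreducible highest weight module has $[\widehat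 R^{(\pm)}\mathrm{ch}^{(\pm)}_{L(\Lambda^{(M)(m,m_2)(\mathrm I)}_{k_1,k_2})}](\tau,z,t)=[\widehat R^{(\pm)}\mathrm{ch}^{(\pm)}_{L(\Lambda^{(m,m_2)})}]\big(M\tau,z+\tau\beta,\frac1M(t+(z|\beta)+\frac{\tau|\beta|^2}2)\big)$. Twisted functions are $f^{\mathrm{tw}}(h)=f(w_0h)$ with $w_0=r_{\alpha_2}t_{-\frac12\alpha_2}$, i.e. $w_0(\tau,z_1,z_2,t)=(\tau,-z_2+\frac\tau2,-z_1+\frac\tau2,t+\frac{z_1+z_2}2-\frac\tau4)$. For $0\le m_2\le m-1$, $\ddot L(\Lambda^{(M)(m,m_2)(\mathrm I)}_{k_1,k_2})=L(\Lambda^{(M)(m,m_2)(\mathrm I)}_{k_1,k_2})\oplus L(\Lambda^{(M)(m,m_2+1)(\mathrm I)}_{k_1,k_2})$, with $\mathrm{ch}^{(\pm)}_{\ddot L}=\mathrm{ch}^{(\pm)}_{L(\Lambda^{(M)(m,m_2)(\mathrm I)}_{k_1,k_2})}\pm\mathrm{ch}^{(\pm)}_{L(\Lambda^{(M)(m,m_2+1)(\mathrm I)}_{k_1,k_2})}$ and the same for twisted characters. N=4 characters. $\overset{N=4}{\ddot H}(\Lambda)$ is the quantum Hamiltonian reduction of $\ddot L(\Lambda)$ for $(x=\frac12\theta,f=e_{-\theta})$, a module of the N=4 superconformal algebra of central charge $-6(\frac mM+1)$. Its characters are given by $[\overset{N=4}R{}^{(\pm)}\mathrm{ch}^{(\pm)}_{\ddot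 H}](\tau,z)=[\widehat R^{(\pm)}\mathrm{ch}^{(\pm)}_{\ddot L}](\tau,z+\frac\tau2,z-\frac\tau2,\frac\tau4)$, and likewise with ''tw'' throughout, where the N=4 denominators are $\overset{N=4}R{}^{(+)}=-i\frac{\eta(\tau)^3\vartheta_{11}(\tau,2z)}{\vartheta_{00}(\tau,z)^2}$, $\overset{N=4}R{}^{(+)\mathrm{tw}}=-i\frac{\eta(\tau)^3\vartheta_{11}(\tau,2z)}{\vartheta_{10}(\tau,z)^2}$. *)

(* Defs.v *)
From Stdlib Require Import Reals ZArith List Classical Lra Lia.
From Coquelicot Require Import Coquelicot.
Import ListNotations.
Local Open Scope C_scope.

Definition Cexp (z : C) : C := RtoC (exp (Re z)) * (cos (Im z), sin (Im z)).

Definition Csum_list {I : Type} (f : I -> C) (l : list I) : C :=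
  fold_right Cplus 0 (map f l).

(* Unconditional convergence of the family (f i), i ranging over D, to s: the
   net of finite partial sums tends to s.  In C this is the same as absolute
   convergence. *)
Definition has_sum_on {I : Type} (D : I -> Prop) (f : I -> C) (s : C) : Prop :=
  forall eps : R, (0 < eps)%R ->
    exists l0 : list I, List.Forall D l0 /\
      forall l : list I, NoDup l -> List.Forall D l -> incl l0 l ->
        (Cmod (Csum_list f l - s) < eps)%R.

Definition summable_on {I : Type} (D : I -> Prop) (f : I -> C) : Prop :=
  exists s : C, has_sum_on D f s.

(* The value is meaningful only for summable families, see [Csum_on_correct]. *)
Definition Csum_on {I : Type} (D : I -> Prop) (f : I -> C) : C :=
  iota (T := C_CompleteNormedModule) (fun s : C => has_sum_on D f s).

Definition allZ : Z -> Prop := fun _ => True.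

Lemma NoDup_same_elements {I : Type} (l : list I) :
  exists l' : list I, NoDup l' /\ incl l l' /\ incl l' l.
Proof.
induction l as [|a l [l' [N [H1 H2]]]].
- exists nil; repeat split; [constructor | easy | easy].
- destruct (classic (In a l')) as [Ha | Ha].
  + exists l'; repeat split; trivial.
    * intros x [<- | Hx]; auto.
    * intros x Hx; right; auto.
  + exists (a :: l'); repeat split.
    * now constructor.
    * intros x [<- | Hx]; [now left | right; auto].
    * intros x [<- | Hx]; [now left | right; auto].
Qed.

Lemma has_sum_on_unique {I : Type} (D : I -> Prop) (f : I -> C) (s s' : C) :
  has_sum_on D f s -> has_sum_on D f s' -> s = s'.
Proof.
intros H H'.
destruct (Req_dec (Cmod (s - s')) 0) as [E | E].
- apply Cmod_eq_0 in E.
  replace s with ((s - s') + s') by ring. rewrite E; ring.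
- assert (P : (0 < Cmod (s - s') / 2)%R).
  { pose proof (Cmod_ge_0 (s - s')); lra. }
  destruct (H _ P) as [l1 [D1 K1]]; destruct (H' _ P) as [l2 [D2 K2]].
  destruct (NoDup_same_elements (l1 ++ l2)) as [l [N [I1 I2]]].
  assert (DL : List.Forall D l).
  { apply List.Forall_forall; intros x Hx; apply I2 in Hx.
    rewrite List.Forall_forall in D1, D2.
    apply in_app_or in Hx; destruct Hx; auto. }
  specialize (K1 l N DL (fun x Hx => I1 x (in_or_app _ _ _ (or_introl Hx)))).
  specialize (K2 l N DL (fun x Hx => I1 x (in_or_app _ _ _ (or_intror Hx)))).
  exfalso.
  pose proof (Cmod_triangle (- (Csum_list f l - s)) (Csum_list f l - s')) as T.
  rewrite Cmod_opp in T.
  replace (- (Csum_list f l - s) + (Csum_list f l - s')) with (s - s') in T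
    by ring.
  lra.
Qed.

Lemma Csum_on_correct {I : Type} (D : I -> Prop) (f : I -> C) (s : C) :
  has_sum_on D f s -> Csum_on D f = s.
Proof.
intros H; unfold Csum_on.
apply (iota_unique (V := C_CompleteNormedModule)); trivial.
intros y Hy; exact (has_sum_on_unique D f y s Hy H).
Qed.

Definition Clim (u : nat -> C) : C :=
  iota (T := C_CompleteNormedModule) (fun l : C => filterlim u eventually (locally l)).

Lemma Clim_correct (u : nat -> C) (l : C) :
  filterlim u eventually (locally l) -> Clim u = l.
Proof.
intros H; unfold Clim.
apply (iota_unique (V := C_CompleteNormedModule)); trivial.
intros y Hy.
exact (filterlim_locally_unique (V := C_CompleteNormedModule) u y l Hy H).
Qed.

Definition qpow (tau : C) (a : R) : C := Cexp (2 * PI * Ci * a * tau).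

Definition vartheta (a b : Z) (tau z : C) : C :=
  Csum_on allZ (fun n : Z =>
    Cexp (PI * Ci * ((IZR n + IZR a / 2) ^ 2)%R * tau
          + 2 * PI * Ci * (IZR n + IZR a / 2)%R * (z + (IZR b / 2)%R))).

Fixpoint Cprod_upto (u : nat -> C) (N : nat) : C :=
  match N with
  | O => 1
  | S N' => Cprod_upto u N' * u N
  end.

Definition dedekind_eta (tau : C) : C :=
  qpow tau (1 / 24)
  * Clim (Cprod_upto (fun n : nat => 1 - qpow tau (INR n))).

(* The Cartan subalgebra of the affine superalgebra A(1,1)^, identified with its
   dual: Wt a b c d is a Lambda_0 + b alpha_1 + c alpha_2 + d delta. *)
Record wt : Type := Wt { wL : C; w1 : C; w2 : C; wd : C }.

Definition wadd (x y : wt) : wt :=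
  Wt (wL x + wL y) (w1 x + w1 y) (w2 x + w2 y) (wd x + wd y).
Definition wscal (c : C) (x : wt) : wt :=
  Wt (c * wL x) (c * w1 x) (c * w2 x) (c * wd x).

Declare Scope wt_scope.
Delimit Scope wt_scope with wt.
Bind Scope wt_scope with wt.
Notation "x + y" := (wadd x y) : wt_scope.
Notation "c *: x" := (wscal c%C x) (at level 40, x at next level) : wt_scope.
Notation "- x" := (wscal (- (1))%C x) : wt_scope.
Notation "x - y" := (wadd x (wscal (- (1))%C y)) : wt_scope.

Definition form (x y : wt) : C :=
  wL x * wd y + wd x * wL y
  + (w1 x * w2 y + w2 x * w1 y) - 2 * (w2 x * w2 y).

Definition Lambda0 : wt := Wt 1 0 0 0.
Definition delta : wt := Wt 0 0 0 1.
Definition alpha1 : wt := Wt 0 1 0 0.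
Definition alpha2 : wt := Wt 0 0 1 0.
(* The odd simple roots alpha_1 and alpha_3 coincide on the Cartan subalgebra. *)
Definition alpha3 : wt := alpha1.
Definition alpha0 : wt := (delta - (alpha1 + alpha2 + alpha3))%wt.
Definition theta : wt := (alpha1 + alpha2 + alpha3)%wt.
Definition rho : wt := ((- (1 / 2)) *: (alpha1 + alpha3))%wt.

Lemma form_simple_roots :
  (form alpha0 alpha0 = 2 /\ form alpha2 alpha2 = - (2)) /\
  (form alpha1 alpha1 = 0 /\ form alpha3 alpha3 = 0 /\
   form alpha1 alpha3 = 0 /\ form alpha0 alpha2 = 0) /\
  (form alpha0 alpha1 = - (1) /\ form alpha0 alpha3 = - (1)) /\
  (form alpha1 alpha2 = 1 /\ form alpha2 alpha3 = 1).
Proof.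
repeat split; unfold form, alpha0, alpha3, alpha1, alpha2, delta; simpl; ring.
Qed.

Lemma form_Lambda0 :
  form Lambda0 Lambda0 = 0 /\ form Lambda0 alpha0 = 1 /\
  form Lambda0 alpha1 = 0 /\ form Lambda0 alpha2 = 0 /\
  form Lambda0 alpha3 = 0.
Proof.
repeat split; unfold form, Lambda0, alpha0, alpha3, alpha1, alpha2, delta;
  simpl; ring.
Qed.

Definition tr (alpha lambda : wt) : wt :=
  (lambda + form lambda delta *: alpha
   - (form alpha alpha / 2 * form lambda delta + form lambda alpha) *: delta)%wt.

Definition r_theta (lambda : wt) : wt :=
  (lambda - form lambda theta *: theta)%wt.
Definition r_alpha2 (lambda : wt) : wt :=
  (lambda + form lambda alpha2 *: alpha2)%wt.

Definition w0 (lambda : wt) : wt :=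
  r_alpha2 (tr ((- (1 / 2)) *: alpha2)%wt lambda).

(* The coordinates (tau, z, t) on the Cartan subalgebra, z lying in the span of
   alpha_1, alpha_2. *)
Definition pt (tau : C) (z : wt) (t : C) : wt :=
  ((2 * PI * Ci) *: ((- tau) *: Lambda0 + z + t *: delta))%wt.

Definition tau_of (h : wt) : C := - (wL h / (2 * PI * Ci)).
Definition z_of (h : wt) : wt :=
  Wt 0 (w1 h / (2 * PI * Ci)) (w2 h / (2 * PI * Ci)) 0.
Definition t_of (h : wt) : C := wd h / (2 * PI * Ci).

Definition zvec (z1 z2 : C) : wt :=
  ((- ((z1 - z2) / 2)) *: (alpha1 + alpha3) - z1 *: alpha2)%wt.

Definition pt4 (tau z1 z2 t : C) : wt := pt tau (zvec z1 z2) t.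

(* The value of e^lambda at the point h. *)
Definition expw (lambda h : wt) : C := Cexp (form lambda h).

Lemma wt_eq (x y : wt) :
  wL x = wL y -> w1 x = w1 y -> w2 x = w2 y -> wd x = wd y -> x = y.
Proof.
destruct x, y; simpl; intros; subst; reflexivity.
Qed.

Lemma two_PI_Ci_neq_0 : 2 * PI * Ci <> 0.
Proof.
intros H. apply (f_equal Im) in H. simpl in H.
pose proof PI_RGT_0. lra.
Qed.

Lemma C2_neq_0 : RtoC 2 <> 0.
Proof. intros H; apply RtoC_inj in H; lra. Qed.

Lemma pt_of_coords (h : wt) : pt (tau_of h) (z_of h) (t_of h) = h.
Proof.
apply wt_eq; unfold pt, tau_of, z_of, t_of, Lambda0, delta; simpl; field;
  repeat split; try (intros E; apply RtoC_inj in E; pose proof PI_RGT_0; lra);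
  intros E; apply (f_equal Im) in E; simpl in E; lra.
Qed.

Lemma w0_pt4 (tau z1 z2 t : C) :
  w0 (pt4 tau z1 z2 t)
  = pt4 tau (- z2 + tau / 2) (- z1 + tau / 2) (t + (z1 + z2) / 2 - tau / 4).
Proof.
assert (H4 : RtoC 4 <> 0) by (intros H; apply RtoC_inj in H; lra).
pose proof C2_neq_0.
apply wt_eq; unfold w0, r_alpha2, tr, form, pt4, pt, zvec, Lambda0, alpha3,
  alpha1, alpha2, delta; simpl; field; repeat split; assumption.
Qed.

Lemma form_tr (alpha lambda h : wt) :
  wL alpha = 0 -> form (tr alpha lambda) h = form lambda (tr (- alpha)%wt h).
Proof.
intros E; pose proof C2_neq_0.
unfold tr, form, delta; simpl; rewrite E; field; assumption.
Qed.

Lemma form_r_theta (lambda h : wt) :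
  form (r_theta lambda) h = form lambda (r_theta h).
Proof.
unfold r_theta, form, theta, alpha3, alpha1, alpha2; simpl; ring.
Qed.

(* Plus: characters; Minus: supercharacters. *)
Inductive sgn : Type := Plus | Minus.
Definition sgnC (s : sgn) : C := match s with Plus => 1 | Minus => - (1) end.

Definition Lambda (m m2 : Z) : wt :=
  (IZR m *: Lambda0 + (IZR m2 / 2) *: (alpha1 + alpha3))%wt.

(* An isometry w acts on functions by (w f)(h) = f (w^-1 h), so that
   w (e^lambda) = e^(w lambda), see [form_tr] and [form_r_theta]; the inverse of
   t_alpha is t_(-alpha), and r_theta is an involution. *)
Definition num_seed (s : sgn) (m m2 : Z) (h : wt) : C :=
  expw (Lambda m m2 + rho)%wt h
  / ((1 + sgnC s * expw (- alpha1)%wt h) * (1 + sgnC s * expw (- alpha3)%wt h)).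

Definition num_F (s : sgn) (m m2 : Z) (h : wt) : C :=
  Csum_on allZ (fun j : Z => num_seed s m m2 (tr (- (IZR j *: theta))%wt h)).

(* The numerator, i.e. the (super)denominator times the (super)character, of
   L(Lambda^(m,m2)). *)
Definition num_L (s : sgn) (m m2 : Z) (h : wt) : C :=
  num_F s m m2 h - num_F s m m2 (r_theta h).

Definition beta_I (k1 k2 : Z) : wt :=
  ((- (IZR (2 * k1 + k2) / 2)) *: (alpha1 + alpha3) - IZR k1 *: alpha2)%wt.

(* The numerator of the principal admissible module L(Lambda^(M)(m,m2)(I)_(k1,k2)). *)
Definition num_PA (s : sgn) (M m m2 k1 k2 : Z) (h : wt) : C :=
  let tau := tau_of h in
  let z := z_of h in
  let t := t_of h in
  let beta := beta_I k1 k2 in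
  num_L s m m2
    (pt (IZR M * tau) (z + tau *: beta)%wt
        (1 / IZR M * (t + form z beta + tau * form beta beta / 2))).

(* The numerator of the direct sum of the modules with labels m2 and m2 + 1. *)
Definition num_ddL (s : sgn) (M m m2 k1 k2 : Z) (h : wt) : C :=
  num_PA s M m m2 k1 k2 h + sgnC s * num_PA s M m (m2 + 1) k1 k2 h.

Definition twist (f : wt -> C) (h : wt) : C := f (w0 h).

Definition N4_pt (tau z : C) : wt :=
  pt4 tau (z + tau / 2) (z - tau / 2) (tau / 4).

Definition N4_R (tau z : C) : C :=
  - Ci * (dedekind_eta tau ^ 3 * vartheta 1 1 tau (2 * z)
          / vartheta 0 0 tau z ^ 2).

Definition N4_R_tw (tau z : C) : C :=
  - Ci * (dedekind_eta tau ^ 3 * vartheta 1 1 tau (2 * z)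
          / vartheta 1 0 tau z ^ 2).

(* The character ch^(+), resp. twisted character ch^(+)tw, of the quantum
   Hamiltonian reduction of the module with numerator [num_ddL]. *)
Definition N4_ch_ddH (M m m2 k1 k2 : Z) (tau z : C) : C :=
  num_ddL Plus M m m2 k1 k2 (N4_pt tau z) / N4_R tau z.

Definition N4_ch_ddH_tw (M m m2 k1 k2 : Z) (tau z : C) : C :=
  twist (num_ddL Plus M m m2 k1 k2) (N4_pt tau z) / N4_R_tw tau z.

Definition both_nonneg (p : Z * Z) : Prop := (0 <= fst p /\ 0 <= snd p)%Z.
Definition both_neg (p : Z * Z) : Prop := (fst p < 0 /\ snd p < 0)%Z.

(* [ sum over j, k >= 0 - sum over j, k < 0 ] g (j, k) *)
Definition indefinite_sum (g : Z * Z -> C) : C :=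
  Csum_on both_nonneg g - Csum_on both_neg g.

Definition indefinite_summable (g : Z * Z -> C) : Prop :=
  summable_on both_nonneg g /\ summable_on both_neg g.

(* (-1)^j q^(j(j+1)/2 + jk + (nu+2k)^2/2) at the index (j, k) = p. *)
Definition ddH_term (tau : C) (nu : R) (p : Z * Z) : C :=
  let j := IZR (fst p) in
  let k := IZR (snd p) in
  powerRZ (-1) (fst p)
  * qpow tau (1 / 2 * j * (j + 1) + j * k + 1 / 2 * (nu + 2 * k) ^ 2)%R.

(* Main.v *)
Require Import Defs.
From Stdlib Require Import Reals ZArith List FinFun Classical Lra Lia.
From Coquelicot Require Import Coquelicot.
Import ListNotations.
Local Open Scope C_scope.

(** Write [q = e^T] with [T = 2 pi i tau], [x = e^(2 pi i z)] and [y = e^w]. Two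
    functions carry the proof: the theta series
    [theta(y) = sum_n (-1)^n q^(n(n-1)/2) y^n] and the level one Appell function
    [S(y) = sum_n (-1)^n q^(n(n+1)/2) / (1 - y q^n)].

    Left-hand side. Adding the labels [m2 = 0] and [m2 = 1] turns the double poles of
    the two seeds into a simple pole, since [u/(1+u)^2 + 1/(1+u)^2 = 1/(1+u)]. At the
    points where the numerator is evaluated the coordinates satisfy [z1 - z2 = tau].
    With [M = 2] the sum over the translations [t_(j theta)] then produces exactly the
    terms of [S] with even [n], and the part reflected by [r_theta] those with odd [n]:
    the numerator is an elementary factor times [S(-x q^(1/2))], respectively
    [S(-q/x)] in the twisted case, which the quasi-periodicity of [S] reduces to
    [S(-1/x)] ([num_ddL_eq], [has_sum_appell_quot_shift]).

    Right-hand side. Expanding the denominators of [S(y)] geometrically, for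
    [|q| < |y| < 1], gives the sum of [(-1)^j q^(j(j+1)/2+jk) y^k] over [j, k >= 0]
    minus the one over [j, k < 0]. Multiply by [sum_n q^((n+c)^2/2) x^n] and
    replace [n] by [n + 2k]: at [y = x^(-2)] the factors [x^(2k)] cancel and the
    coefficient of [x^n] is the indefinite theta series of the statement
    ([has_sum_fourier]). So the right-hand side is a theta function times
    [S(x^(-2))]. The condition on [z] puts all the arguments of [S] above in the
    annulus [|q| < |y| < 1].

    Both sides agree because [S(y) theta(y)] does not depend on [y] in the annulus
    ([appell_mul_theta_series]). Indeed the coefficient [p_m] of [y^m] in this product
    satisfies [p_m = q^m p_m], so that only [p_0] survives. Comparing at
    [-x q^(1/2)] or [-1/x] with [x^(-2)], and expressing the Mumford theta functions
    through [theta], yields the two formulas, provided that one can divide by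
    [theta(x^(-2))], a factor of [vartheta_11(tau, 2z)].

    That [theta] has no zero in the annulus ([theta_series_neq_0]) follows
    from the duplication identity
    [theta(y;q) theta(-y;q) = theta(q;q^2) theta(y^2;q^2)]: by repeated squaring the
    claim is reduced to parameters for which the term [n = 0] dominates the series. *)

(** * Unconditional sums of complex families *)

Definition full {I : Type} : I -> Prop := fun _ => True.

Lemma Forall_full {I : Type} (l : list I) : List.Forall full l.
Proof. apply List.Forall_forall; easy. Qed.

Lemma Csum_list_app {I : Type} (f : I -> C) (l l' : list I) :
  Csum_list f (l ++ l') = Csum_list f l + Csum_list f l'.
Proof.
unfold Csum_list; induction l as [|a l IH]; simpl; [ring | rewrite IH; ring].
Qed.

Lemma Csum_list_ext {I : Type} (f g : I -> C) (l : list I) :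
  (forall i, In i l -> f i = g i) -> Csum_list f l = Csum_list g l.
Proof.
unfold Csum_list; induction l as [|a l IH]; simpl; intros H; trivial.
rewrite IH, H; auto.
Qed.

Lemma Csum_list_plus {I : Type} (f g : I -> C) (l : list I) :
  Csum_list (fun i => f i + g i) l = Csum_list f l + Csum_list g l.
Proof.
unfold Csum_list; induction l as [|a l IH]; simpl; [ring | rewrite IH; ring].
Qed.

Lemma Csum_list_scal {I : Type} (c : C) (f : I -> C) (l : list I) :
  Csum_list (fun i => c * f i) l = c * Csum_list f l.
Proof.
unfold Csum_list; induction l as [|a l IH]; simpl; [ring | rewrite IH; ring].
Qed.

Lemma Csum_list_map {I J : Type} (phi : I -> J) (f : J -> C) (l : list I) :
  Csum_list f (map phi l) = Csum_list (fun i => f (phi i)) l.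
Proof. unfold Csum_list; now rewrite map_map. Qed.

Lemma Csum_list_filter {I : Type} (p : I -> bool) (f : I -> C) (l : list I) :
  Csum_list f (filter p l) = Csum_list (fun i => if p i then f i else 0) l.
Proof.
unfold Csum_list; induction l as [|a l IH]; simpl; trivial.
destruct (p a); simpl; rewrite IH; ring.
Qed.

Lemma has_sum_on_ext {I : Type} (D : I -> Prop) (f g : I -> C) (s : C) :
  (forall i, D i -> f i = g i) -> has_sum_on D f s -> has_sum_on D g s.
Proof.
intros E H eps He; destruct (H eps He) as [l0 [D0 K]].
exists l0; split; trivial; intros l N Dl Il.
rewrite <- (Csum_list_ext f); auto.
rewrite List.Forall_forall in Dl; auto.
Qed.

Lemma has_sum_on_eq {I : Type} (D : I -> Prop) (f : I -> C) (s s' : C) :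
  s = s' -> has_sum_on D f s -> has_sum_on D f s'.
Proof. now intros ->. Qed.

Lemma has_sum_on_plus {I : Type} (D : I -> Prop) (f g : I -> C) (a b : C) :
  has_sum_on D f a -> has_sum_on D g b ->
  has_sum_on D (fun i => f i + g i) (a + b).
Proof.
intros Hf Hg eps He.
destruct (Hf (eps / 2)%R ltac:(lra)) as [l1 [D1 K1]].
destruct (Hg (eps / 2)%R ltac:(lra)) as [l2 [D2 K2]].
exists (l1 ++ l2); split; [apply List.Forall_app; auto|].
intros l N Dl Il.
specialize (K1 l N Dl (fun x Hx => Il x (in_or_app _ _ _ (or_introl Hx)))).
specialize (K2 l N Dl (fun x Hx => Il x (in_or_app _ _ _ (or_intror Hx)))).
rewrite Csum_list_plus.
replace (Csum_list f l + Csum_list g l - (a + b))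
  with ((Csum_list f l - a) + (Csum_list g l - b)) by ring.
eapply Rle_lt_trans; [apply Cmod_triangle | lra].
Qed.

Lemma has_sum_on_scal {I : Type} (D : I -> Prop) (c : C) (f : I -> C) (a : C) :
  has_sum_on D f a -> has_sum_on D (fun i => c * f i) (c * a).
Proof.
intros Hf eps He.
assert (P : (0 < Cmod c + 1)%R) by (pose proof (Cmod_ge_0 c); lra).
destruct (Hf (eps / (Cmod c + 1))%R) as [l0 [D0 K]].
{ now apply Rdiv_lt_0_compat. }
exists l0; split; trivial; intros l N Dl Il; specialize (K l N Dl Il).
rewrite Csum_list_scal.
replace (c * Csum_list f l - c * a) with (c * (Csum_list f l - a)) by ring.
rewrite Cmod_mult.
apply Rle_lt_trans with ((Cmod c) * (eps / (Cmod c + 1)))%R.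
- apply Rmult_le_compat_l; [apply Cmod_ge_0 | lra].
- apply Rlt_le_trans with ((Cmod c + 1) * (eps / (Cmod c + 1)))%R.
  + apply Rmult_lt_compat_r; [now apply Rdiv_lt_0_compat | lra].
  + right; field; lra.
Qed.

Lemma has_sum_on_minus {I : Type} (D : I -> Prop) (f g : I -> C) (a b : C) :
  has_sum_on D f a -> has_sum_on D g b ->
  has_sum_on D (fun i => f i - g i) (a - b).
Proof.
intros Hf Hg.
apply has_sum_on_eq with (a + - (1) * b); [ring|].
eapply has_sum_on_ext;
  [| exact (has_sum_on_plus _ _ _ _ _ Hf (has_sum_on_scal _ (- (1)) _ _ Hg))].
intros i _; simpl; ring.
Qed.

(** As [D'] may be smaller than the codomain, this also restricts a sum to the range of
    an injection. *)
Lemma has_sum_on_reindex {I J : Type} (D : I -> Prop) (D' : J -> Prop)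
  (phi : I -> J) (f : J -> C) (s : C) :
  (forall i i', D i -> D i' -> phi i = phi i' -> i = i') ->
  (forall i, D i -> D' (phi i)) ->
  (forall j, D' j -> exists i, D i /\ phi i = j) ->
  has_sum_on D' f s -> has_sum_on D (fun i => f (phi i)) s.
Proof.
intros Inj Sub Sur H eps He; destruct (H eps He) as [l0' [D0 K]].
assert (P : exists l0, List.Forall D l0 /\ incl l0' (map phi l0)).
{ clear K; induction D0 as [|j l Hj Hl [l0 [F0 I0]]].
  - exists nil; split; [constructor | easy].
  - destruct (Sur j Hj) as [i [Di <-]].
    exists (i :: l0); split; [now constructor|].
    intros y [<- | Hy]; [now left | right; auto]. }
destruct P as [l0 [F0 I0]]; exists l0; split; trivial.
intros l N Dl Il.
rewrite <- Csum_list_map; apply K.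
- rewrite List.Forall_forall in Dl; clear Il.
  induction N as [|i l Hi N IH]; simpl; constructor.
  + intros Hin; apply in_map_iff in Hin; destruct Hin as [i' [E Hi']].
    apply Hi; rewrite <- (Inj i' i); simpl in *; auto.
  + apply IH; intros; apply Dl; now right.
- apply List.Forall_forall; intros j Hj; apply in_map_iff in Hj.
  destruct Hj as [i [<- Hi]]; apply Sub.
  rewrite List.Forall_forall in Dl; auto.
- intros j Hj; apply I0 in Hj; apply in_map_iff in Hj.
  destruct Hj as [i [<- Hi]]; apply in_map; auto.
Qed.

Lemma has_sum_on_indicator {I : Type} (D : I -> Prop) (p : I -> bool)
  (f : I -> C) (s : C) :
  (forall i, p i = true <-> D i) ->
  has_sum_on D f s -> has_sum_on full (fun i => if p i then f i else 0) s.
Proof.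
intros Hp H eps He; destruct (H eps He) as [l0 [D0 K]].
exists l0; split; [apply Forall_full|]; intros l N _ Il.
rewrite <- Csum_list_filter; apply K.
- now apply NoDup_filter.
- apply List.Forall_forall; intros i Hi; apply filter_In in Hi.
  now apply Hp.
- intros i Hi; apply filter_In; split; auto; apply Hp.
  rewrite List.Forall_forall in D0; auto.
Qed.

Lemma has_sum_on_single {I : Type} (i0 : I) (f : I -> C) :
  (forall i, i <> i0 -> f i = 0) -> has_sum_on full f (f i0).
Proof.
intros Hf eps He; exists [i0]; split; [apply Forall_full|].
intros l N _ Il.
assert (Z : forall l', ~ In i0 l' -> Csum_list f l' = 0).
{ unfold Csum_list; induction l' as [|a l' IH]; simpl; intros Hn; trivial.
  rewrite IH, Hf by tauto; ring. }
assert (E : Csum_list f l = f i0).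
{ assert (Hin : In i0 l) by (apply Il; now left).
  apply in_split in Hin; destruct Hin as [l1 [l2 ->]].
  apply NoDup_remove_2 in N.
  rewrite Csum_list_app; change (i0 :: l2) with ([i0] ++ l2).
  rewrite Csum_list_app, (Z l1), (Z l2).
  - change (Csum_list f [i0]) with (f i0 + 0); ring.
  - intros H; apply N, in_or_app; auto.
  - intros H; apply N, in_or_app; auto. }
rewrite E; replace (f i0 - f i0) with (RtoC 0) by ring.
now rewrite Cmod_0.
Qed.

Definition Rsum_list {I : Type} (g : I -> R) (l : list I) : R :=
  fold_right Rplus 0%R (map g l).

Lemma Rsum_list_app {I : Type} (f : I -> R) (l l' : list I) :
  Rsum_list f (l ++ l') = (Rsum_list f l + Rsum_list f l')%R.
Proof.
unfold Rsum_list; induction l as [|a l IH]; simpl; [ring | rewrite IH; ring].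
Qed.

Lemma Rsum_list_nonneg {I : Type} (g : I -> R) (l : list I) :
  (forall i, 0 <= g i)%R -> (0 <= Rsum_list g l)%R.
Proof.
intros Hg; unfold Rsum_list; induction l as [|a l IH]; simpl; [lra|].
specialize (Hg a); lra.
Qed.

Lemma Rsum_list_le {I : Type} (f g : I -> R) (l : list I) :
  (forall i, In i l -> f i <= g i)%R -> (Rsum_list f l <= Rsum_list g l)%R.
Proof.
unfold Rsum_list; induction l as [|a l IH]; simpl; intros H; [lra|].
specialize (IH (fun i Hi => H i (or_intror Hi))).
specialize (H a (or_introl eq_refl)); lra.
Qed.

Lemma Rsum_list_scal {I : Type} (c : R) (f : I -> R) (l : list I) :
  Rsum_list (fun i => c * f i)%R l = (c * Rsum_list f l)%R.
Proof.
unfold Rsum_list; induction l as [|a l IH]; simpl; [ring | rewrite IH; ring].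
Qed.

Lemma Rsum_list_map {I J : Type} (phi : I -> J) (f : J -> R) (l : list I) :
  Rsum_list f (map phi l) = Rsum_list (fun i => f (phi i)) l.
Proof. unfold Rsum_list; now rewrite map_map. Qed.

Lemma Rsum_list_incl {I : Type} (g : I -> R) (l l' : list I) :
  (forall i, 0 <= g i)%R -> NoDup l -> incl l l' ->
  (Rsum_list g l <= Rsum_list g l')%R.
Proof.
intros Hg N; revert l'; induction N as [|a l Ha N IH]; intros l' Il.
- now apply Rsum_list_nonneg.
- assert (Hin : In a l') by (apply Il; now left).
  apply in_split in Hin; destruct Hin as [l1 [l2 ->]].
  assert (Il' : incl l (l1 ++ l2)).
  { intros x Hx; assert (Hx' := Il x (or_intror Hx)).
    apply in_app_or in Hx'; apply in_or_app.
    destruct Hx' as [|[->|]]; auto; contradiction. }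
  (* Remove from the longer list one occurrence of the head of the shorter one. *)
  specialize (IH _ Il'); rewrite Rsum_list_app in IH |- *.
  change (a :: l) with ([a] ++ l); change (a :: l2) with ([a] ++ l2).
  rewrite !Rsum_list_app; lra.
Qed.

Lemma Cmod_Csum_list {I : Type} (f : I -> C) (l : list I) :
  (Cmod (Csum_list f l) <= Rsum_list (fun i => Cmod (f i)) l)%R.
Proof.
unfold Csum_list, Rsum_list; induction l as [|a l IH]; simpl.
- rewrite Cmod_0; lra.
- eapply Rle_trans; [apply Cmod_triangle | lra].
Qed.

Definition abs_summable {I : Type} (f : I -> C) : Prop :=
  exists B : R, forall l : list I, NoDup l ->
    (Rsum_list (fun i => Cmod (f i)) l <= B)%R.

(** The sum is the supremum of the finite partial sums. *)
Lemma nonneg_bounded_has_sum {I : Type} (D : I -> Prop) (g : I -> R) (B : R) :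
  (forall i, 0 <= g i)%R ->
  (forall l, NoDup l -> (Rsum_list g l <= B)%R) ->
  exists s : R, has_sum_on D (fun i => RtoC (g i)) s.
Proof.
intros Hg HB.
pose (E := fun x : R => exists l, NoDup l /\ List.Forall D l /\ x = Rsum_list g l).
destruct (completeness E) as [s [Us Ls]].
- exists B; intros x [l [N [_ ->]]]; auto.
- exists 0%R, nil; repeat split; constructor.
- exists s; intros eps He.
  assert (P : exists l0, NoDup l0 /\ List.Forall D l0 /\ (s - eps < Rsum_list g l0)%R).
  { apply NNPP; intros Hn.
    assert (s <= s - eps)%R; [|lra].
    apply Ls; intros x [l [N [Dl ->]]].
    destruct (Rle_lt_dec (Rsum_list g l) (s - eps)); trivial.
    exfalso; apply Hn; eauto. }
  destruct P as [l0 [N0 [D0 K0]]]; exists l0; split; trivial.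
  intros l N Dl Il.
  assert (H1 : (Rsum_list g l <= s)%R) by (apply Us; exists l; auto).
  assert (H2 := Rsum_list_incl g l0 l Hg N0 Il).
  assert (E1 : Csum_list (fun i => RtoC (g i)) l = Rsum_list g l).
  { unfold Csum_list, Rsum_list; clear; induction l; simpl; trivial.
    rewrite IHl, RtoC_plus; trivial. }
  rewrite E1, <- RtoC_minus, Cmod_R; apply Rabs_def1; lra.
Qed.

(** Each of [Re f] and [Im f] is a difference of two nonnegative families bounded by
    [2 |f|], for instance [(|f| + Re f) - |f|], and bounded nonnegative families are
    summable. *)
Lemma abs_summable_summable_on {I : Type} (D : I -> Prop) (f : I -> C) :
  abs_summable f -> summable_on D f.
Proof.
intros [B HB].
assert (A : forall z : C, (- Cmod z <= Re z <= Cmod z)%R /\ (- Cmod z <= Im z <= Cmod z)%R).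
{ intros [x y]; pose proof (Rmax_Cmod (x, y)) as H; simpl in *.
  pose proof (Rmax_l (Rabs x) (Rabs y)); pose proof (Rmax_r (Rabs x) (Rabs y)).
  split; apply Rabs_le_between; lra. }
assert (S : forall g : I -> R, (forall i, 0 <= g i <= 2 * Cmod (f i))%R ->
  exists s : R, has_sum_on D (fun i => RtoC (g i)) s).
{ intros g Hg; apply nonneg_bounded_has_sum with (2 * B)%R; [apply Hg|].
  intros l N; apply Rle_trans with (Rsum_list (fun i => 2 * Cmod (f i))%R l).
  - apply Rsum_list_le; intros; apply Hg.
  - rewrite Rsum_list_scal; specialize (HB l N); lra. }
destruct (S (fun i => Cmod (f i))) as [s0 H0].
{ intros i; pose proof (Cmod_ge_0 (f i)); lra. }
destruct (S (fun i => Cmod (f i) + Re (f i))%R) as [s1 H1].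
{ intros i; specialize (A (f i)); lra. }
destruct (S (fun i => Cmod (f i) + Im (f i))%R) as [s2 H2].
{ intros i; specialize (A (f i)); lra. }
exists ((s1 - s0) + Ci * (s2 - s0)).
eapply has_sum_on_ext; [| exact (has_sum_on_plus _ _ _ _ _
  (has_sum_on_minus _ _ _ _ _ H1 H0)
  (has_sum_on_scal _ Ci _ _ (has_sum_on_minus _ _ _ _ _ H2 H0)))].
intros i _; apply injective_projections; simpl; unfold Re, Im; ring.
Qed.

Lemma abs_summable_has_sum {I : Type} (f : I -> C) :
  abs_summable f -> has_sum_on full f (Csum_on full f).
Proof.
intros H; destruct (abs_summable_summable_on full f H) as [s Hs].
now rewrite (Csum_on_correct _ _ _ Hs).
Qed.

Lemma abs_summable_le {I : Type} (f : I -> C) (g : I -> C) (c : R) :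
  (forall i, Cmod (f i) <= c * Cmod (g i))%R -> abs_summable g -> abs_summable f.
Proof.
intros Hfg [B HB]; exists (Rabs c * B)%R; intros l N.
apply Rle_trans with (Rsum_list (fun i => Rabs c * Cmod (g i))%R l).
- apply Rsum_list_le; intros i _; eapply Rle_trans; [apply Hfg|].
  apply Rmult_le_compat_r; [apply Cmod_ge_0 | apply Rle_abs].
- rewrite Rsum_list_scal; apply Rmult_le_compat_l; [apply Rabs_pos | auto].
Qed.

Lemma abs_summable_comp {I J : Type} (phi : I -> J) (f : J -> C) :
  (forall i i', phi i = phi i' -> i = i') ->
  abs_summable f -> abs_summable (fun i => f (phi i)).
Proof.
intros Inj [B HB]; exists B; intros l N.
change (Rsum_list (fun i => (fun j => Cmod (f j)) (phi i)) l <= B)%R.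
rewrite <- Rsum_list_map; apply HB.
now apply Injective_map_NoDup.
Qed.

Lemma abs_summable_prod {I J : Type} (f : I -> C) (g : J -> C) :
  abs_summable f -> abs_summable g ->
  abs_summable (fun p : I * J => f (fst p) * g (snd p)).
Proof.
intros [A HA] [B HB]; exists (A * B)%R; intros l N.
destruct (NoDup_same_elements (map fst l)) as [l1 [N1 [I1 _]]].
destruct (NoDup_same_elements (map snd l)) as [l2 [N2 [I2 _]]].
apply Rle_trans with
  (Rsum_list (fun p : I * J => Cmod (f (fst p) * g (snd p))) (list_prod l1 l2)).
{ apply Rsum_list_incl; trivial.
  - intros; apply Cmod_ge_0.
  - intros [i j] Hp; apply in_prod_iff; split.
    + apply I1; change i with (fst (i, j)); now apply in_map.
    + apply I2; change j with (snd (i, j)); now apply in_map. }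
assert (E : forall la, Rsum_list (fun p : I * J => Cmod (f (fst p) * g (snd p)))
    (list_prod la l2)
  = (Rsum_list (fun i => Cmod (f i)) la * Rsum_list (fun j => Cmod (g j)) l2)%R).
{ induction la as [|a la IH]; simpl; [unfold Rsum_list; simpl; ring|].
  rewrite Rsum_list_app, IH, Rsum_list_map; simpl.
  change (a :: la) with ([a] ++ la); rewrite Rsum_list_app, Rmult_plus_distr_r.
  f_equal.
  transitivity (Rsum_list (fun j => Cmod (f a) * Cmod (g j))%R l2).
  - unfold Rsum_list; f_equal; apply map_ext; intros; apply Cmod_mult.
  - rewrite Rsum_list_scal; unfold Rsum_list at 2; simpl; ring. }
rewrite E; apply Rmult_le_compat; auto; apply Rsum_list_nonneg; intros; apply Cmod_ge_0.
Qed.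

(** Over finitely many rows the sum of the [g i] is approximated by sums of [F] over
    finite sets of indices that contain any prescribed finite part of these rows. *)
Lemma has_sum_on_fubini {I J : Type} (F : I * J -> C) (g : I -> C) (s : C) :
  has_sum_on full F s ->
  (forall i, has_sum_on full (fun j => F (i, j)) (g i)) ->
  has_sum_on full g s.
Proof.
intros HF Hg eps He.
destruct (HF (eps / 2)%R ltac:(lra)) as [L0 [_ K0]].
exists (map fst L0); split; [apply Forall_full|]; intros l N _ Il.
(* The rows are approximated one after the other, half of the remaining error being
   spent on each; the approximation contains the part of L0 lying in these rows. *)
assert (P : forall l, NoDup l -> exists L : list (I * J), NoDup L /\
  (forall p, In p L -> In (fst p) l) /\
  (forall p, In p L0 -> In (fst p) l -> In p L) /\
  (Cmod (Csum_list F L - Csum_list g l) < eps / 2)%R).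
{ clear l N Il; intros l N.
  assert (He' : (0 < eps / 2)%R) by lra; revert He'.
  generalize (eps / 2)%R; clear eps He K0.
  induction N as [|i l Hi N IH]; intros eps He.
  - exists nil; repeat split; [constructor | easy | easy|].
    replace (Csum_list F [] - Csum_list g []) with (RtoC 0)
      by (unfold Csum_list; simpl; ring).
    now rewrite Cmod_0.
  - destruct (IH (eps / 2)%R ltac:(lra)) as [L [NL [L1 [L2 L3]]]].
    destruct (Hg i (eps / 2)%R ltac:(lra)) as [r0 [_ Kr]].
    assert (X : exists r1, forall p, In p L0 -> fst p = i -> In (snd p) r1).
    { exists (map snd L0); intros p Hp _; now apply in_map. }
    destruct X as [r1 X].
    destruct (NoDup_same_elements (r0 ++ r1)) as [r [Nr [Ir _]]].
    exists (map (pair i) r ++ L); split; [|split; [|split]].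
    + apply NoDup_app; trivial.
      * apply Injective_map_NoDup; trivial.
        intros a b E; now injection E.
      * intros p Hp HL; apply in_map_iff in Hp; destruct Hp as [j [<- _]].
        now apply L1 in HL.
    + intros p Hp; apply in_app_or in Hp; destruct Hp as [Hp|Hp].
      * apply in_map_iff in Hp; destruct Hp as [j [<- _]]; now left.
      * right; auto.
    + intros p Hp Hfp; apply in_or_app; simpl in Hfp; destruct Hfp as [E|Hfp].
      * left; destruct p as [i' j]; simpl in E; subst i'.
        apply in_map, Ir, in_or_app; right.
        exact (X (i, j) Hp eq_refl).
      * right; auto.
    + rewrite Csum_list_app, Csum_list_map.
      specialize (Kr r Nr (Forall_full _)
        (fun x Hx => Ir x (in_or_app _ _ _ (or_introl Hx)))).
      change (Csum_list g (i :: l)) with (g i + Csum_list g l).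
      match goal with |- (Cmod (?a + ?b - (?c + ?d)) < _)%R =>
        replace (a + b - (c + d)) with ((a - c) + (b - d)) by ring end.
      eapply Rle_lt_trans; [apply Cmod_triangle | lra]. }
destruct (P l N) as [L [NL [_ [L2 L3]]]].
assert (K := K0 L NL (Forall_full _) (fun p Hp => L2 p Hp (Il _ (in_map fst _ _ Hp)))).
replace (Csum_list g l - s)
  with (- (Csum_list F L - Csum_list g l) + (Csum_list F L - s)) by ring.
eapply Rle_lt_trans; [apply Cmod_triangle | rewrite Cmod_opp; lra].
Qed.

(** Absolute summability provides the double sum; its value is found by rows: these
    have the sums [f i * b], which add up to [a * b]. *)
Lemma has_sum_on_prod {I J : Type} (f : I -> C) (g : J -> C) (a b : C) :
  abs_summable f -> abs_summable g -> has_sum_on full f a -> has_sum_on full g b ->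
  has_sum_on full (fun p : I * J => f (fst p) * g (snd p)) (a * b).
Proof.
intros Af Ag Hf Hg.
assert (H := abs_summable_has_sum _ (abs_summable_prod f g Af Ag)).
eapply has_sum_on_eq; [|exact H].
apply (has_sum_on_unique full (fun i => b * f i)).
- apply (has_sum_on_fubini _ _ _ H); intros i; simpl.
  apply has_sum_on_eq with (f i * b); [ring|].
  now apply has_sum_on_scal.
- apply has_sum_on_eq with (b * a); [ring | now apply has_sum_on_scal].
Qed.

(** The index 0 is left out because the bound is used to show that the term of
    index 0 dominates a series. *)
Lemma Rsum_list_geom (r : R) (l : list Z) :
  (0 <= r < 1)%R -> NoDup l -> ~ In 0%Z l ->
  (Rsum_list (fun n => r ^ Z.abs_nat n)%R l <= 2 * r / (1 - r))%R.
Proof.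
intros Hr N Hl.
assert (X : exists M, forall n, In n l -> (Z.abs_nat n <= M)%nat).
{ clear N Hl; induction l as [|a l [M HM]]; [now exists 0%nat|].
  exists (Z.abs_nat a + M)%nat; intros n [<-|Hn]; [lia|].
  specialize (HM n Hn); lia. }
destruct X as [M HM].
apply Rle_trans with (Rsum_list (fun n => r ^ Z.abs_nat n)%R
  (map Z.of_nat (seq 1 M) ++ map (fun n => - Z.of_nat n)%Z (seq 1 M))).
{ apply Rsum_list_incl; trivial.
  - intros; now apply pow_le.
  - intros n Hn; assert (n <> 0%Z) by (intros ->; auto).
    specialize (HM n Hn); apply in_or_app.
    destruct (Z_lt_le_dec 0 n); [left|right]; apply in_map_iff;
      exists (Z.abs_nat n); (split; [lia | apply in_seq; lia]). }
rewrite Rsum_list_app, !Rsum_list_map.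
assert (E : forall s : Z -> Z, (forall n, Z.abs_nat (s n) = Z.abs_nat n) ->
  (Rsum_list (fun i => r ^ Z.abs_nat (s (Z.of_nat i)))%R (seq 1 M) <= r / (1 - r))%R).
{ intros s Hs.
  assert (Y : forall M a, (Rsum_list (fun i => r ^ Z.abs_nat (s (Z.of_nat i)))%R
    (seq a M) = (r ^ a - r ^ (a + M)) / (1 - r))%R).
  { clear M HM; induction M as [|M IH]; intros a.
    - rewrite Nat.add_0_r; unfold Rsum_list; simpl; field; lra.
    - simpl seq; change (a :: seq (S a) M) with ([a] ++ seq (S a) M).
      rewrite Rsum_list_app, IH; unfold Rsum_list; simpl map; simpl fold_right.
      rewrite Hs, Zabs2Nat.id.
      replace (a + S M)%nat with (S a + M)%nat by lia.
      change (r ^ S a)%R with (r * r ^ a)%R; field; lra. }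
  rewrite Y; apply Rmult_le_compat_r.
  - left; apply Rinv_0_lt_compat; lra.
  - pose proof (pow_le r (1 + M) ltac:(lra)); simpl; simpl in *; lra. }
assert (E1 := E (fun n => n) (fun _ => eq_refl)).
assert (E2 := E Z.opp ltac:(intros; lia)); simpl in E1, E2.
lra.
Qed.

Lemma abs_summable_geom (r : R) (f : Z -> C) (c : R) :
  (0 <= r < 1)%R -> (forall n, Cmod (f n) <= c * r ^ Z.abs_nat n)%R ->
  abs_summable f.
Proof.
intros Hr Hf.
apply abs_summable_le with (g := fun n => RtoC (r ^ Z.abs_nat n)) (c := c).
- intros n; rewrite Cmod_R, Rabs_pos_eq by now apply pow_le.
  apply Hf.
- exists (1 + 2 * r / (1 - r))%R; intros l N.
  assert (X : Rsum_list (fun i => Cmod (r ^ Z.abs_nat i)%R) l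
    = Rsum_list (fun n => r ^ Z.abs_nat n)%R l).
  { unfold Rsum_list; f_equal; apply map_ext; intros n.
    rewrite Cmod_R, Rabs_pos_eq; trivial; now apply pow_le. }
  rewrite X; clear X.
  set (l' := filter (fun n => negb (Z.eqb n 0)) l).
  apply Rle_trans with (Rsum_list (fun n => r ^ Z.abs_nat n)%R ([0%Z] ++ l')).
  + apply Rsum_list_incl; trivial.
    * intros; now apply pow_le.
    * intros n Hn; destruct (Z.eq_dec n 0) as [->|H]; [now left|right].
      apply filter_In; split; trivial.
      now apply Bool.negb_true_iff, Z.eqb_neq.
  + rewrite Rsum_list_app; apply Rplus_le_compat.
    * unfold Rsum_list; simpl; lra.
    * apply Rsum_list_geom; trivial; [now apply NoDup_filter|].
      intros H; apply filter_In in H; destruct H; discriminate.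
Qed.

Lemma abs_summable_scal {I : Type} (a : C) (f : I -> C) :
  abs_summable f -> abs_summable (fun i => a * f i).
Proof.
apply abs_summable_le with (c := Cmod a); intros i; rewrite Cmod_mult; lra.
Qed.

Lemma abs_summable_plus {I : Type} (f g : I -> C) :
  abs_summable f -> abs_summable g -> abs_summable (fun i => f i + g i).
Proof.
intros [A HA] [B HB]; exists (A + B)%R; intros l N.
apply Rle_trans with
  (Rsum_list (fun i => Cmod (f i)) l + Rsum_list (fun i => Cmod (g i)) l)%R.
- unfold Rsum_list; clear; induction l as [|a l IH]; simpl; [lra|].
  assert (X := Cmod_triangle (f a) (g a)); lra.
- specialize (HA l N); specialize (HB l N); lra.
Qed.

Lemma has_sum_on_bij {I J : Type} (phi : I -> J) (psi : J -> I) (f : J -> C) (s : C) :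
  (forall i, psi (phi i) = i) -> (forall j, phi (psi j) = j) ->
  has_sum_on full f s -> has_sum_on full (fun i => f (phi i)) s.
Proof.
intros H1 H2; apply has_sum_on_reindex.
- intros i i' _ _ E; rewrite <- (H1 i), E; auto.
- easy.
- intros j _; exists (psi j); split; [easy | auto].
Qed.

Lemma has_sum_on_shift (c : Z) (f : Z -> C) (s : C) :
  has_sum_on full f s -> has_sum_on full (fun n => f (n + c)%Z) s.
Proof.
apply (has_sum_on_bij (fun n => n + c)%Z (fun n => n - c)%Z); intros; lia.
Qed.

Lemma has_sum_on_reflect (c : Z) (f : Z -> C) (s : C) :
  has_sum_on full f s -> has_sum_on full (fun n => f (c - n)%Z) s.
Proof.
apply (has_sum_on_bij (fun n => c - n)%Z (fun n => c - n)%Z); intros; lia.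
Qed.

Lemma has_sum_on_line_l (i0 : Z) (f : Z -> C) (s : C) :
  has_sum_on full f s ->
  has_sum_on full (fun p : Z * Z => if (fst p =? i0)%Z then f (snd p) else 0) s.
Proof.
intros H; apply (has_sum_on_indicator (fun p : Z * Z => fst p = i0)
  (fun p => (fst p =? i0)%Z) (fun p => f (snd p))).
- intros p; apply Z.eqb_eq.
- apply (has_sum_on_reindex _ full snd); trivial; [|easy|].
  + intros [a b] [a' b']; simpl; intros; congruence.
  + intros j _; now exists (i0, j).
Qed.

Lemma has_sum_on_line_r (j0 : Z) (f : Z -> C) (s : C) :
  has_sum_on full f s ->
  has_sum_on full (fun p : Z * Z => if (snd p =? j0)%Z then f (fst p) else 0) s.
Proof.
intros H; apply (has_sum_on_indicator (fun p : Z * Z => snd p = j0)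
  (fun p => (snd p =? j0)%Z) (fun p => f (fst p))).
- intros p; apply Z.eqb_eq.
- apply (has_sum_on_reindex _ full fst); trivial; [|easy|].
  + intros [a b] [a' b']; simpl; intros; congruence.
  + intros j _; now exists (j, j0).
Qed.

(** The even integers are written [-2 j] and the odd ones [-2 j - 1], the form in
    which they come from the translations [t_(j theta)] and from their reflections. *)
Lemma has_sum_even_odd (f : Z -> C) (a b : C) :
  abs_summable f ->
  has_sum_on full (fun j => f (-2 * j)%Z) a ->
  has_sum_on full (fun j => f (-2 * j - 1)%Z) b ->
  has_sum_on full f (a + b).
Proof.
intros Hf Ha Hb.
destruct (abs_summable_summable_on (fun n => Z.even n = true) f Hf) as [e He].
destruct (abs_summable_summable_on (fun n => Z.even n = false) f Hf) as [o Ho].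
assert (Ee : a = e).
{ apply (has_sum_on_unique _ _ _ _ Ha).
  apply (has_sum_on_reindex full (fun n => Z.even n = true)); trivial.
  - intros; lia.
  - intros i _; apply Z.even_spec; exists (- i)%Z; lia.
  - intros n Hn; apply Z.even_spec in Hn; destruct Hn as [c Hc].
    exists (- c)%Z; split; [easy | lia]. }
assert (Eo : b = o).
{ apply (has_sum_on_unique _ _ _ _ Hb).
  apply (has_sum_on_reindex full (fun n => Z.even n = false)); trivial.
  - intros; lia.
  - intros i _; rewrite <- Z.negb_odd; apply Bool.negb_false_iff, Z.odd_spec.
    exists (- i - 1)%Z; lia.
  - intros n Hn; rewrite <- Z.negb_odd in Hn.
    apply Bool.negb_false_iff, Z.odd_spec in Hn; destruct Hn as [c Hc].
    exists (- c - 1)%Z; split; [easy | lia]. }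
subst e o.
eapply has_sum_on_ext; [|apply has_sum_on_plus;
  [exact (has_sum_on_indicator _ Z.even _ _ (fun p => iff_refl _) He)
  |exact (has_sum_on_indicator _ (fun p => negb (Z.even p)) _ _
     (fun p => Bool.negb_true_iff (Z.even p)) Ho)]].
intros n _; cbv beta; destruct (Z.even n); simpl; ring.
Qed.

(** * The exponential and the theta series *)

(** With this value at 0, both sides of the character formulas vanish in case
    [dedekind_eta tau = 0]. *)
Lemma Cinv_0 : / (RtoC 0) = 0.
Proof. unfold Cinv; simpl; apply injective_projections; simpl; unfold Rdiv; ring. Qed.

Lemma Ci_neq_0 : Ci <> 0.
Proof. intros E; apply (f_equal Im) in E; simpl in E; lra. Qed.

Lemma CPI_neq_0 : RtoC PI <> 0.
Proof. intros H; apply RtoC_inj in H; pose proof PI_RGT_0; lra. Qed.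

Lemma C4_neq_0 : RtoC 4 <> 0.
Proof. intros H; apply RtoC_inj in H; lra. Qed.

Lemma C_eq_opp_0 (a : C) : a = - a -> a = 0.
Proof.
destruct a as [x y]; intros E; injection E; intros; apply injective_projections;
  simpl; lra.
Qed.

Ltac push_IZR :=
  repeat rewrite ?plus_IZR, ?minus_IZR, ?opp_IZR, ?mult_IZR.
Ltac Ceq := push_IZR; apply injective_projections; simpl; unfold Re, Im; try field.

Lemma Cexp_plus (a b : C) : Cexp (a + b) = Cexp a * Cexp b.
Proof.
unfold Cexp; destruct a as [a1 a2], b as [b1 b2]; simpl.
rewrite exp_plus, cos_plus, sin_plus; Ceq.
Qed.

Lemma Cmod_Cexp (a : C) : Cmod (Cexp a) = exp (Re a).
Proof.
unfold Cexp; rewrite Cmod_mult, Cmod_R, Rabs_pos_eq by (left; apply exp_pos).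
unfold Cmod; simpl fst; simpl snd.
replace (cos (Im a) ^ 2 + sin (Im a) ^ 2)%R with 1%R.
- rewrite sqrt_1; ring.
- rewrite <- (sin2_cos2 (Im a)); unfold Rsqr; ring.
Qed.

Lemma Cexp_0 : Cexp 0 = 1.
Proof. unfold Cexp; simpl; rewrite exp_0, cos_0, sin_0; Ceq. Qed.

Lemma Cexp_neq_0 (a : C) : Cexp a <> 0.
Proof.
intros H; apply (f_equal Cmod) in H; rewrite Cmod_Cexp, Cmod_0 in H.
pose proof (exp_pos (Re a)); lra.
Qed.

Definition altsign (n : Z) : C := RtoC (powerRZ (-1) n).

Lemma altsign_plus (m n : Z) : altsign (m + n) = altsign m * altsign n.
Proof. unfold altsign; rewrite powerRZ_add, RtoC_mult; trivial; lra. Qed.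

Lemma altsign_square (n : Z) : altsign n * altsign n = 1.
Proof.
unfold altsign; rewrite <- RtoC_mult, <- powerRZ_mult.
replace (-1 * -1)%R with 1%R by ring; now rewrite powerRZ_R1.
Qed.

Lemma altsign_double (n : Z) : altsign (2 * n) = 1.
Proof. rewrite <- (altsign_square n), <- altsign_plus; f_equal; lia. Qed.

Lemma altsign_1 : altsign 1 = - (1).
Proof. unfold altsign; simpl; Ceq. Qed.

Lemma altsign_opp (n : Z) : altsign (- n) = altsign n.
Proof.
replace n with (- n + 2 * n)%Z at 2 by lia.
rewrite altsign_plus, altsign_double; ring.
Qed.

Lemma altsign_succ (n : Z) : altsign (n + 1) = - altsign n.
Proof. rewrite altsign_plus, altsign_1; ring. Qed.

Lemma Cmod_altsign (n : Z) : Cmod (altsign n) = 1%R.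
Proof.
unfold altsign; rewrite Cmod_R.
assert (H := f_equal Cmod (altsign_square n)); unfold altsign in H.
rewrite Cmod_mult, Cmod_1, Cmod_R in H.
pose proof (Rabs_pos (powerRZ (-1) n)); nra.
Qed.

Lemma Cexp_PI_Ci : Cexp (PI * Ci) = - (1).
Proof.
unfold Cexp; simpl.
replace (PI * 0 - 0 * 1)%R with 0%R by ring.
replace (PI * 1 + 0 * 0)%R with PI by ring.
rewrite exp_0, cos_PI, sin_PI; Ceq.
Qed.

Lemma Cexp_half_shift (x : C) : Cexp (x + PI * Ci) = - Cexp x.
Proof. rewrite Cexp_plus, Cexp_PI_Ci; ring. Qed.

Lemma Cexp_half_PI : Cexp (PI * Ci / 2) = Ci.
Proof.
unfold Cexp.
replace (PI * Ci / 2) with ((0, PI / 2)%R : C) by Ceq.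
simpl; rewrite exp_0, cos_PI2, sin_PI2; Ceq.
Qed.

Lemma Cexp_opp (a : C) : Cexp (- a) = / Cexp a.
Proof.
pose proof (Cexp_neq_0 a).
assert (E : Cexp (- a) * Cexp a = 1).
{ rewrite <- Cexp_plus, <- Cexp_0; f_equal; ring. }
transitivity (Cexp (- a) * Cexp a / Cexp a); [field; trivial|].
rewrite E; field; trivial.
Qed.

Lemma Cexp_altsign (n : Z) : Cexp (PI * Ci * IZR n) = altsign n.
Proof.
assert (P : forall k : nat, Cexp (PI * Ci * INR k) = altsign (Z.of_nat k)).
{ induction k as [|k IH].
  - simpl INR; simpl Z.of_nat; rewrite Cmult_0_r, Cexp_0; unfold altsign; simpl; trivial.
  - rewrite S_INR, RtoC_plus, Cmult_plus_distr_l, Cexp_plus, IH, Cmult_1_r,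
      Cexp_PI_Ci, Nat2Z.inj_succ; unfold Z.succ; rewrite altsign_succ; ring. }
destruct (Z_le_gt_dec 0 n) as [H|H].
- rewrite <- (Z2Nat.id n) by lia; rewrite <- INR_IZR_INZ; apply P.
- rewrite <- altsign_opp, <- (Z2Nat.id (- n)) by lia; rewrite <- P, INR_IZR_INZ,
    Z2Nat.id, opp_IZR by lia.
  replace (PI * Ci * IZR n) with (- (PI * Ci * (- IZR n)%R)) by Ceq.
  rewrite Cexp_opp, <- opp_IZR, <- (Z2Nat.id (- n)) by lia.
  rewrite <- INR_IZR_INZ, P.
  pose proof (altsign_square (Z.of_nat (Z.to_nat (- n)))) as E.
  set (a := altsign _) in *.
  assert (a <> 0) by (intros Z; rewrite Z, Cmult_0_l in E;
    apply (f_equal fst) in E; simpl in E; lra).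
  rewrite <- (Cmult_1_l (/ a)), <- E; field; trivial.
Qed.

Lemma exp_opp_nat (c : R) (k : nat) : exp (- (INR k * c)) = (exp (- c) ^ k)%R.
Proof.
induction k as [|k IH].
- simpl; rewrite Rmult_0_l, Ropp_0; apply exp_0.
- rewrite S_INR; simpl pow; rewrite <- IH, <- exp_plus; f_equal; ring.
Qed.

Lemma exp_opp_Zabs (c : R) (n : Z) :
  (exp (- c) ^ Z.abs_nat n)%R = exp (- (Rabs (IZR n) * c)).
Proof.
rewrite <- exp_opp_nat, INR_IZR_INZ, Zabs2Nat.id_abs, abs_IZR; trivial.
Qed.

Lemma exp_opp_lt_1 (c : R) : (0 < c)%R -> (0 <= exp (- c) < 1)%R.
Proof.
intros Hc; split; [left; apply exp_pos|].
rewrite <- exp_0; apply exp_increasing; lra.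
Qed.

(** Normalised so that the series vanishes at [y = e^w = 1]: with [q = e^T] the term
    is [(-1)^n q^(n(n-1)/2) y^n]. *)
Definition theta_term (T w : C) (n : Z) : C :=
  altsign n * Cexp ((IZR n * (IZR n - 1) / 2)%R * T + IZR n * w).

Definition theta_series (T w : C) : C := Csum_on full (theta_term T w).

Lemma Cmod_theta_term (T w : C) (n : Z) :
  Cmod (theta_term T w n)
  = exp (IZR n * (IZR n - 1) / 2 * Re T + IZR n * Re w).
Proof.
unfold theta_term; rewrite Cmod_mult, Cmod_altsign, Cmod_Cexp, Rmult_1_l.
f_equal; simpl; unfold Re, Im; field.
Qed.

(** The quadratic part of the exponent wins: with [A = - Re T] the difference
    [A (n^2 - |n|)/2 - |n| |Re w| - |n|] is bounded below, as one sees by completing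
    the square in [|n|]. *)
Lemma abs_summable_theta (T w : C) :
  (Re T < 0)%R -> abs_summable (theta_term T w).
Proof.
intros HT.
set (A := (- Re T)%R); set (B := Re w).
(* K is the loss in completing the square; the 1 in b leaves a factor e^(-|n|). *)
set (b := (A / 2 + Rabs B + 1)%R); set (K := (b * b / (2 * A))%R).
apply abs_summable_geom with (r := exp (Ropp 1)) (c := exp K).
{ apply exp_opp_lt_1; lra. }
intros n; rewrite Cmod_theta_term, exp_opp_Zabs, <- exp_plus.
replace (Re T) with (- A)%R by (unfold A; ring); fold B.
assert (HA : (0 < A)%R) by (unfold A; lra).
set (x := IZR n); set (y := Rabs x).
assert (Hx : (x * x = y * y)%R)
  by (unfold y; rewrite <- Rabs_mult; symmetry; apply Rabs_pos_eq; nra).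
assert (H1 : (x <= y)%R) by apply Rle_abs.
assert (H2 : (x * B <= y * Rabs B)%R).
{ unfold y; rewrite <- Rabs_mult; apply Rle_abs. }
assert (H3 : (0 <= A / 2 * (y - b / A) ^ 2)%R).
{ apply Rmult_le_pos; [lra | apply pow2_ge_0]. }
assert (E : (A / 2 * (y - b / A) ^ 2 = A / 2 * (y * y) - b * y + K)%R)
  by (unfold K; field; lra).
rewrite E in H3; unfold b in H3.
assert (P : (x * (x - 1) / 2 * - A + x * B <= K + - (y * 1))%R).
{ assert (x * A <= y * A)%R by (apply Rmult_le_compat_r; lra); nra. }
destruct P as [P|P]; [left; now apply exp_increasing | right; now rewrite P].
Qed.

Lemma has_sum_theta (T w : C) :
  (Re T < 0)%R -> has_sum_on full (theta_term T w) (theta_series T w).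
Proof. intros HT; now apply abs_summable_has_sum, abs_summable_theta. Qed.

Lemma has_sum_theta_opp (T w : C) :
  (Re T < 0)%R -> has_sum_on full (fun n => theta_term T w (- n)) (theta_series T w).
Proof.
intros HT.
eapply has_sum_on_ext; [|exact (has_sum_on_reflect 0 _ _ (has_sum_theta T w HT))].
intros n _; reflexivity.
Qed.

Lemma theta_term_shift (T : C) (n : Z) :
  Cexp ((IZR n * (IZR n + 1) / 2)%R * T) = altsign n * theta_term T T n.
Proof.
unfold theta_term; rewrite Cmult_assoc, altsign_square, Cmult_1_l; f_equal; Ceq.
Qed.

Lemma theta_term_antiperiod (T w : C) (n : Z) :
  theta_term T (w + PI * Ci) n = Cexp ((IZR n * (IZR n - 1) / 2)%R * T + IZR n * w).
Proof.
unfold theta_term.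
replace (IZR n * (w + PI * Ci)) with (PI * Ci * IZR n + IZR n * w) by ring.
rewrite !Cexp_plus, Cexp_altsign.
transitivity (altsign n * altsign n
    * (Cexp ((IZR n * (IZR n - 1) / 2)%R * T) * Cexp (IZR n * w)));
  [ring | rewrite altsign_square; ring].
Qed.

(** The substitution [n -> 1 - n] reverses the sign of every term. *)
Lemma theta_series_0 (T : C) : (Re T < 0)%R -> theta_series T 0 = 0.
Proof.
intros HT; assert (H := has_sum_theta T 0 HT).
apply C_eq_opp_0, (has_sum_on_unique full (theta_term T 0)); trivial.
apply (has_sum_on_reflect 1), (has_sum_on_scal _ (- (1))) in H.
apply has_sum_on_eq with (- (1) * theta_series T 0); [ring|].
eapply has_sum_on_ext; [|exact H]; intros n _; unfold theta_term.
replace (1 - n)%Z with (- n + 1)%Z by lia.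
rewrite altsign_succ, altsign_opp.
replace ((IZR (- n + 1) * (IZR (- n + 1) - 1) / 2)%R * T + IZR (- n + 1) * 0)
  with ((IZR n * (IZR n - 1) / 2)%R * T + IZR n * 0) by Ceq.
ring.
Qed.

(** * The level one Appell function *)

(** In terms of [q = e^T] and [y = e^w]: [|q| < |y| < 1]. *)
Definition annulus (T w : C) : Prop := (Re T < Re w < 0)%R.

(** The sign that makes a sum over all of [Z x Z] out of the difference of the
    sums over the nonnegative and the negative quadrant. *)
Definition quadrant_sign (p : Z * Z) : C :=
  if ((0 <=? fst p) && (0 <=? snd p))%bool%Z then 1
  else if ((fst p <? 0) && (snd p <? 0))%bool%Z then - (1) else 0.

(** At index [(j, k)]: the term in [y^k] of the geometric expansion of the [j]-th term
    of the Appell function, in powers of [y q^j] for [j >= 0] and of its inverse for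
    [j < 0]. *)
Definition appell_term (T w : C) (p : Z * Z) : C :=
  quadrant_sign p * (altsign (fst p) * Cexp
    ((IZR (fst p) * (IZR (fst p) + 1) / 2 + IZR (fst p) * IZR (snd p))%R * T
     + IZR (snd p) * w)).

Definition appell (T w : C) : C := Csum_on full (appell_term T w).

Definition appell_quot (T w : C) (n : Z) : C :=
  altsign n * Cexp ((IZR n * (IZR n + 1) / 2)%R * T) / (1 - Cexp (w + IZR n * T)).

(** On both quadrants the exponent is bounded by a constant minus [A |j| + d |k|],
    where [A = - Re T] and [d] is the distance of [Re w] to the ends of the
    interval [(Re T, 0)]. For negative indices this uses
    [j(j+1)/2 + j k = (|j|-1) |j| / 2 + (|j|-1) |k| + |k|]. *)
Lemma abs_summable_appell (T w : C) :
  annulus T w -> abs_summable (appell_term T w).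
Proof.
intros [H1 H2].
set (A := (- Re T)%R); set (B := (- Re w)%R); set (d := Rmin B (A - B)).
assert (HB : (0 < B)%R) by (unfold B; lra).
assert (HAB : (0 < A - B)%R) by (unfold A, B; lra).
assert (HA : (0 < A)%R) by lra.
assert (Hd : (0 < d)%R) by (apply Rmin_pos; trivial).
assert (d1 : (d <= B)%R) by apply Rmin_l.
assert (d2 : (d <= A - B)%R) by apply Rmin_r.
apply abs_summable_le with (c := exp A)
  (g := fun p : Z * Z => RtoC (exp (- A) ^ Z.abs_nat (fst p))
                         * RtoC (exp (- d) ^ Z.abs_nat (snd p))).
- intros [j k]; unfold appell_term; simpl fst; simpl snd.
  rewrite !Cmod_mult, Cmod_altsign, Cmod_Cexp, !Cmod_R, Rmult_1_l.
  rewrite !exp_opp_Zabs, !(Rabs_pos_eq (exp _)) by (left; apply exp_pos).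
  rewrite <- !exp_plus.
  unfold quadrant_sign; simpl fst; simpl snd.
  assert (E : Re ((IZR j * (IZR j + 1) / 2 + IZR j * IZR k)%R * T + IZR k * w)
    = (- ((IZR j * (IZR j + 1) / 2 + IZR j * IZR k) * A) - IZR k * B)%R)
    by (unfold A, B; simpl; unfold Re, Im; field).
  rewrite E.
  destruct (Z.leb_spec 0 j), (Z.leb_spec 0 k), (Z.ltb_spec j 0), (Z.ltb_spec k 0);
    try lia; simpl andb; cbv iota; rewrite ?Cmod_opp, ?Cmod_1, ?Cmod_0, ?Rmult_1_l,
    ?Rmult_0_l; try (left; apply exp_pos).
  + assert (Hj : (0 <= IZR j)%R) by now apply (IZR_le 0).
    assert (Hk : (0 <= IZR k)%R) by now apply (IZR_le 0).
    rewrite !Rabs_pos_eq by trivial.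
    assert (Hjj : (0 <= IZR j * (IZR j - 1))%R).
    { destruct (Z.eq_dec j 0) as [->|]; [lra|].
      assert (1 <= IZR j)%R by (apply (IZR_le 1); lia); nra. }
    match goal with |- (exp ?a <= exp ?b)%R => assert (P : (a <= b)%R) end.
    { assert (0 <= A * (IZR j * IZR k))%R by (apply Rmult_le_pos; [lra | nra]).
      assert (0 <= A * (IZR j * (IZR j - 1)))%R by (apply Rmult_le_pos; lra).
      assert (IZR k * d <= IZR k * B)%R by nra.
      lra. }
    destruct P as [P|P]; [left; now apply exp_increasing | right; now rewrite P].
  + assert (Hj : (IZR j <= -1)%R) by (apply (IZR_le _ (-1)); lia).
    assert (Hk : (IZR k <= -1)%R) by (apply (IZR_le _ (-1)); lia).
    rewrite !Rabs_left by lra.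
    match goal with |- (exp ?a <= exp ?b)%R => assert (P : (a <= b)%R) end.
    { set (x := (- IZR j)%R) in *; set (y := (- IZR k)%R) in *.
      replace (IZR j) with (- x)%R in * by (unfold x; ring).
      replace (IZR k) with (- y)%R in * by (unfold y; ring).
      assert (Hx : (0 <= (x - 1) * (x - 2))%R).
      { destruct (Z.eq_dec j (-1)) as [Ej|]; [|destruct (Z.eq_dec j (-2)) as [Ej|]].
        - unfold x; rewrite Ej; simpl; lra.
        - unfold x; rewrite Ej; simpl; lra.
        - assert (IZR j <= -3)%R by (apply (IZR_le _ (-3)); lia).
          unfold x; nra. }
      assert (0 <= (x - 1) * y)%R by nra.
      assert (y * d <= y * (A - B))%R by nra.
      assert (0 <= A)%R by lra.
      assert (0 <= A * ((x - 1) * (x - 2)))%R by (apply Rmult_le_pos; lra).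
      assert (0 <= A * ((x - 1) * y))%R by (apply Rmult_le_pos; lra).
      lra. }
    destruct P as [P|P]; [left; now apply exp_increasing | right; now rewrite P].
- apply (abs_summable_prod (fun j : Z => RtoC (exp (- A) ^ Z.abs_nat j))
    (fun k : Z => RtoC (exp (- d) ^ Z.abs_nat k))).
  + assert (R1 := exp_opp_lt_1 A ltac:(lra)).
    apply abs_summable_geom with (r := exp (- A)) (c := 1%R); trivial.
    intros n; rewrite Cmod_R, Rabs_pos_eq; [lra | now apply pow_le].
  + assert (R1 := exp_opp_lt_1 d ltac:(lra)).
    apply abs_summable_geom with (r := exp (- d)) (c := 1%R); trivial.
    intros n; rewrite Cmod_R, Rabs_pos_eq; [lra | now apply pow_le].
Qed.

Lemma Cexp_neq_1 (v : C) : (Re v <> 0)%R -> 1 - Cexp v <> 0.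
Proof.
intros Hv E.
assert (E' : Cexp v = 1) by (replace (Cexp v) with (1 - (1 - Cexp v)) by ring;
  rewrite E; ring).
apply (f_equal Cmod) in E'; rewrite Cmod_Cexp, Cmod_1, <- exp_0 in E'.
now apply exp_inv in E'.
Qed.

(** Shifting the index by one multiplies the family by [e^v] up to its term of
    index 0, which determines the sum. *)
Lemma has_sum_geom_nonneg (v : C) :
  (Re v < 0)%R ->
  has_sum_on full (fun k => if (0 <=? k)%Z then Cexp (IZR k * v) else 0)
    (1 / (1 - Cexp v)).
Proof.
intros Hv; set (f := fun k => if (0 <=? k)%Z then Cexp (IZR k * v) else 0).
assert (Hf : abs_summable f).
{ apply abs_summable_geom with (r := exp (- (- Re v))) (c := 1%R).
  - apply exp_opp_lt_1; lra.
  - intros n; unfold f; rewrite exp_opp_Zabs; destruct (Z.leb_spec 0 n).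
    + rewrite Cmod_Cexp, Rabs_pos_eq by now apply (IZR_le 0).
      right; rewrite Rmult_1_l; f_equal; simpl; unfold Re, Im; ring.
    + rewrite Cmod_0; rewrite Rmult_1_l; left; apply exp_pos. }
apply abs_summable_has_sum in Hf; set (s := Csum_on full f) in *.
assert (H1 := has_sum_on_shift (-1) f s Hf).
assert (H2 : has_sum_on full (fun k : Z => if (k =? 0)%Z then 1 else 0) 1).
{ apply (has_sum_on_single 0%Z); intros i Hi; apply Z.eqb_neq in Hi; now rewrite Hi. }
assert (E : s - Cexp v * s = 1).
{ apply (has_sum_on_unique full (fun k : Z => if (k =? 0)%Z then 1 else 0)); trivial.
  eapply has_sum_on_ext; [|exact (has_sum_on_minus _ _ _ _ _ Hf
    (has_sum_on_scal _ (Cexp v) _ _ H1))].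
  intros k _; unfold f; simpl.
  destruct (Z.leb_spec 0 k), (Z.leb_spec 0 (k + -1)), (Z.eqb_spec k 0); try lia.
  - rewrite <- Cexp_plus.
    replace (v + IZR (k + -1) * v) with (IZR k * v) by Ceq; ring.
  - subst k; rewrite Cmult_0_l, Cexp_0; ring.
  - ring. }
apply has_sum_on_eq with s; trivial.
assert (N := Cexp_neq_1 v ltac:(lra)).
transitivity ((s - Cexp v * s) / (1 - Cexp v)); [field; trivial | rewrite E; trivial].
Qed.

Lemma has_sum_geom_neg (v : C) :
  (0 < Re v)%R ->
  has_sum_on full (fun k => if (k <? 0)%Z then Cexp (IZR k * v) else 0)
    (- (1 / (1 - Cexp v))).
Proof.
intros Hv.
assert (H := has_sum_geom_nonneg (- v) ltac:(simpl; unfold Re in *; lra)).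
apply (has_sum_on_reflect (-1)) in H.
apply (has_sum_on_scal _ (Cexp (- v))) in H.
eapply has_sum_on_eq; [|eapply has_sum_on_ext; [|exact H]].
- assert (N := Cexp_neq_1 v ltac:(lra)); assert (N' := Cexp_neq_0 v).
  rewrite Cexp_opp; field; repeat split; trivial.
  intros E; apply N; replace (1 - Cexp v) with (- (Cexp v - 1)) by ring;
  rewrite E; ring.
- intros k _; cbv beta.
  destruct (Z.leb_spec 0 (-1 - k)), (Z.ltb_spec k 0); try lia; try ring.
  rewrite <- Cexp_plus; f_equal; Ceq.
Qed.

(** The rows of [appell_term] are geometric series: in the annulus [y q^j] has
    modulus less than 1 for [j >= 0] and greater than 1 for [j < 0]. *)
Lemma has_sum_appell_quot (T w : C) :
  annulus T w -> has_sum_on full (appell_quot T w) (appell T w).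
Proof.
intros Hw; assert (H := abs_summable_has_sum _ (abs_summable_appell T w Hw)).
destruct Hw as [H1 H2].
apply (has_sum_on_fubini _ _ _ H); intros j; unfold appell_quot, appell_term; simpl.
set (v := w + IZR j * T).
assert (Ev : Re v = (Re w + IZR j * Re T)%R)
  by (unfold v; simpl; unfold Re, Im; ring).
destruct (Z_le_gt_dec 0 j) as [Hj|Hj].
- assert (Hj' : (0 <= IZR j)%R) by now apply (IZR_le 0).
  assert (Hv : (Re v < 0)%R) by (rewrite Ev; nra).
  eapply has_sum_on_eq; [|eapply has_sum_on_ext; [|exact
    (has_sum_on_scal _ (altsign j * Cexp ((IZR j * (IZR j + 1) / 2)%R * T)) _ _
      (has_sum_geom_nonneg v Hv))]].
  + unfold Cdiv; ring.
  + intros k _; unfold quadrant_sign; simpl.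
    destruct (Z.leb_spec 0 j), (Z.ltb_spec j 0), (Z.leb_spec 0 k); try lia; simpl;
      try ring.
    rewrite <- Cmult_assoc, <- Cexp_plus, Cmult_1_l; do 2 f_equal; unfold v; Ceq.
- assert (Hj' : (IZR j <= -1)%R) by (apply (IZR_le _ (-1)); lia).
  assert (Hv : (0 < Re v)%R) by (rewrite Ev; nra).
  eapply has_sum_on_eq; [|eapply has_sum_on_ext; [|exact
    (has_sum_on_scal _ (- (altsign j * Cexp ((IZR j * (IZR j + 1) / 2)%R * T))) _ _
      (has_sum_geom_neg v Hv))]].
  + unfold Cdiv; ring.
  + intros k _; unfold quadrant_sign; simpl.
    destruct (Z.leb_spec 0 j), (Z.ltb_spec j 0), (Z.ltb_spec k 0); try lia; simpl;
      try ring.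
    replace ((IZR j * (IZR j + 1) / 2 + IZR j * IZR k)%R * T + IZR k * w)
      with ((IZR j * (IZR j + 1) / 2)%R * T + IZR k * v) by (unfold v; Ceq).
    rewrite Cexp_plus; ring.
Qed.

Definition pole_distance (T w : C) (c : R) : Prop :=
  (0 < c)%R /\ forall n : Z, (c <= Cmod (1 - Cexp (w + IZR n * T)))%R.

(** The modulus of [y q^n] stays away from 1: it is at most [|y|] for [n >= 0] and
    at least [|y/q|] for [n < 0]. *)
Lemma appell_denominator_bound (T w : C) :
  annulus T w ->
  exists c : R, pole_distance T w c.
Proof.
intros [H1 H2].
set (c1 := (1 - exp (Re w))%R); set (c2 := (exp (Re w - Re T) - 1)%R).
assert (P1 : (0 < c1)%R)
  by (unfold c1; rewrite <- exp_0; apply Rlt_0_minus, exp_increasing; lra).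
assert (P2 : (0 < c2)%R)
  by (unfold c2; rewrite <- exp_0; apply Rlt_0_minus, exp_increasing; lra).
exists (Rmin c1 c2); split; [now apply Rmin_pos|]; intros n.
set (v := w + IZR n * T).
assert (Ev : Re v = (Re w + IZR n * Re T)%R)
  by (unfold v; simpl; unfold Re, Im; ring).
assert (X1 := Cmod_triangle (1 - Cexp v) (Cexp v)).
assert (X2 := Cmod_triangle (1 - Cexp v) (- (1))).
replace (1 - Cexp v + Cexp v) with (RtoC 1) in X1 by ring.
replace (1 - Cexp v + - (1)) with (- Cexp v) in X2 by ring.
rewrite !Cmod_opp, Cmod_1 in *; rewrite Cmod_Cexp in *.
destruct (Z_le_gt_dec 0 n) as [H|H].
- apply (IZR_le 0) in H; apply Rle_trans with c1; [apply Rmin_l|].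
  assert (exp (Re v) <= exp (Re w))%R; [|unfold c1; lra].
  assert (P : (Re v <= Re w)%R) by (rewrite Ev; nra).
  destruct P as [P|P]; [left; now apply exp_increasing | right; now rewrite P].
- assert (IZR n <= -1)%R by (apply (IZR_le _ (-1)); lia).
  apply Rle_trans with c2; [apply Rmin_r|].
  assert (exp (Re w - Re T) <= exp (Re v))%R; [|unfold c2; lra].
  assert (P : (Re w - Re T <= Re v)%R) by (rewrite Ev; nra).
  destruct P as [P|P]; [left; now apply exp_increasing | right; now rewrite P].
Qed.

(** The quasi-periodicity [S(q y) = - y S(y)]. After a shift of the summation index
    it follows from [q^(-n) / (1 - y q^n) = q^(-n) + y / (1 - y q^n)]: the first
    part contributes the theta series at [y = 1], which vanishes. *)
Lemma has_sum_appell_quot_shift (T w : C) :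
  annulus T w ->
  has_sum_on full (appell_quot T (w + T)) (- Cexp w * appell T w).
Proof.
intros Hw; assert (HT : (Re T < 0)%R) by (destruct Hw; lra).
assert (Hn : forall n, 1 - Cexp (w + IZR n * T) <> 0).
{ intros n; apply Cexp_neq_1; destruct Hw as [H1 H2].
  replace (Re (w + IZR n * T)) with (Re w + IZR n * Re T)%R
    by (simpl; unfold Re, Im; ring).
  destruct (Z_le_gt_dec 0 n) as [H|H].
  - apply (IZR_le 0) in H; nra.
  - assert (IZR n <= -1)%R by (apply (IZR_le _ (-1)); lia); nra. }
assert (H0 := has_sum_theta T 0 HT); rewrite theta_series_0 in H0 by trivial.
assert (H := has_sum_on_minus _ _ _ _ _ (has_sum_on_scal _ (- (1)) _ _ H0)
  (has_sum_on_scal _ (Cexp w) _ _ (has_sum_appell_quot T w Hw))).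
apply (has_sum_on_shift 1) in H.
apply has_sum_on_eq with (- (1) * 0 - Cexp w * appell T w); [ring|].
eapply has_sum_on_ext; [|exact H]; intros n _; cbv beta.
unfold theta_term, appell_quot; rewrite altsign_succ.
specialize (Hn (n + 1)%Z).
replace (w + T + IZR n * T) with (w + IZR (n + 1) * T) by Ceq.
set (V := 1 - Cexp (w + IZR (n + 1) * T)) in *.
replace ((IZR (n + 1) * (IZR (n + 1) - 1) / 2)%R * T + IZR (n + 1) * 0)
  with ((IZR n * (IZR n + 1) / 2)%R * T) by Ceq.
assert (E : Cexp w * Cexp ((IZR (n + 1) * (IZR (n + 1) + 1) / 2)%R * T)
  = (1 - V) * Cexp ((IZR n * (IZR n + 1) / 2)%R * T)).
{ unfold V; replace (1 - (1 - Cexp (w + IZR (n + 1) * T)))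
    with (Cexp (w + IZR (n + 1) * T)) by ring.
  rewrite <- !Cexp_plus; f_equal; Ceq. }
match goal with |- _ - Cexp w * (_ * ?X / _) = ?Y =>
  transitivity (altsign n * Cexp ((IZR n * (IZR n + 1) / 2)%R * T)
    + altsign n * (Cexp w * X) / V) end; [field; trivial|].
rewrite E; field; trivial.
Qed.

(** * The product of the Appell function and the theta series is constant *)

(** The sum over [p = (j, k)] is the coefficient of [e^(m w)] in the product of
    [appell T w] and [theta_series T w]. *)
Definition laurent_term (T : C) (m : Z) (p : Z * Z) : C :=
  appell_term T 0 p * theta_term T 0 (m - snd p).

Lemma quadrant_sign_step (j k : Z) :
  quadrant_sign (j, k) - quadrant_sign (j - 1, k + 1)%Z
  = (if (j =? 0)%Z then 1 else 0) - (if (k =? -1)%Z then 1 else 0).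
Proof.
unfold quadrant_sign; simpl fst; simpl snd.
destruct (Z.leb_spec 0 j), (Z.leb_spec 0 k), (Z.ltb_spec j 0), (Z.ltb_spec k 0),
  (Z.leb_spec 0 (j - 1)), (Z.leb_spec 0 (k + 1)), (Z.ltb_spec (j - 1) 0),
  (Z.ltb_spec (k + 1) 0), (Z.eqb_spec j 0), (Z.eqb_spec k (-1)); try lia; simpl; ring.
Qed.

(** Up to signs, the family [laurent_term T m] is multiplied by [q^(-m)] under
    [(j, k) -> (j - 1, k + 1)]; the sign of the quadrant changes only on the two
    lines [j = 0] and [k = -1]. *)
Lemma laurent_term_step (T : C) (m j k : Z) :
  laurent_term T m (j, k) - Cexp (IZR m * T) * laurent_term T m (j - 1, k + 1)%Z
  = (if (j =? 0)%Z then theta_term T 0 (m - k) else 0)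
    - (if (k =? -1)%Z then theta_term T 0 (m + 1) * theta_term T 0 j else 0).
Proof.
unfold laurent_term, appell_term; cbn [fst snd].
set (u := altsign j * Cexp ((IZR j * (IZR j + 1) / 2 + IZR j * IZR k)%R * T
  + IZR k * 0) * theta_term T 0 (m - k)).
assert (E1 : Cexp (IZR m * T) * (altsign (j - 1) * Cexp
  ((IZR (j - 1) * (IZR (j - 1) + 1) / 2 + IZR (j - 1) * IZR (k + 1))%R * T
   + IZR (k + 1) * 0) * theta_term T 0 (m - (k + 1))) = u).
{ unfold u, theta_term.
  assert (Ea : altsign j = - altsign (j - 1))
    by (rewrite <- altsign_succ; f_equal; lia).
  assert (Eb : altsign (m - k) = - altsign (m - (k + 1)))
    by (rewrite <- altsign_succ; f_equal; lia).
  rewrite Ea, Eb.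
  match goal with |- ?a * (?b * ?c * (?d * ?e)) = - _ * ?c' * (- _ * ?e') =>
    transitivity (b * d * (a * c * e)); [ring |
    transitivity (b * d * (c' * e')); [|ring]] end.
  rewrite <- !Cexp_plus; do 2 f_equal; Ceq. }
transitivity ((quadrant_sign (j, k) - quadrant_sign (j - 1, k + 1)%Z) * u).
{ transitivity (quadrant_sign (j, k) * u - quadrant_sign (j - 1, k + 1)%Z * u); [|ring].
  rewrite <- E1 at 2; unfold u; ring. }
rewrite quadrant_sign_step.
assert (E2 : j = 0%Z -> u = theta_term T 0 (m - k)).
{ intros ->; unfold u; replace (altsign 0) with (RtoC 1) by (unfold altsign; simpl; trivial).
  replace ((0 * (0 + 1) / 2 + 0 * IZR k)%R * T + IZR k * 0) with (RtoC 0) by Ceq.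
  rewrite Cexp_0; ring. }
assert (E3 : k = (-1)%Z -> u = theta_term T 0 (m + 1) * theta_term T 0 j).
{ intros ->; unfold u; replace (m - -1)%Z with (m + 1)%Z by lia.
  unfold theta_term at 3.
  replace ((IZR j * (IZR j + 1) / 2 + IZR j * -1)%R * T + -1 * 0)
    with ((IZR j * (IZR j - 1) / 2)%R * T + IZR j * 0) by Ceq.
  ring. }
destruct (Z.eqb_spec j 0), (Z.eqb_spec k (-1)); rewrite <- ?E2, <- ?E3 by trivial; ring.
Qed.

(** Summing [laurent_term_step] gives [P - q^m P = 0], because on each of the two
    exceptional lines the family is a multiple of the theta series at [y = 1]. *)
Lemma laurent_coef_0 (T : C) (m : Z) (P : C) :
  (Re T < 0)%R -> m <> 0%Z -> has_sum_on full (laurent_term T m) P -> P = 0.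
Proof.
intros HT Hm H.
assert (H' : has_sum_on full
  (fun p => laurent_term T m (fst p - 1, snd p + 1)%Z) P).
{ apply (has_sum_on_bij (fun p => (fst p - 1, snd p + 1)%Z)
    (fun p => (fst p + 1, snd p - 1)%Z)); trivial;
  intros [a b]; simpl; f_equal; lia. }
assert (H0 := has_sum_theta T 0 HT); rewrite theta_series_0 in H0 by trivial.
assert (L : P - Cexp (IZR m * T) * P = 0 - theta_term T 0 (m + 1) * 0).
{ apply (has_sum_on_unique full (fun p =>
    laurent_term T m p - Cexp (IZR m * T) * laurent_term T m (fst p - 1, snd p + 1)%Z)).
  - apply has_sum_on_minus; trivial; now apply has_sum_on_scal.
  - eapply has_sum_on_ext; [|exact (has_sum_on_minus _ _ _ _ _
      (has_sum_on_line_l 0 _ _ (has_sum_on_reflect m _ _ H0))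
      (has_sum_on_line_r (-1) _ _ (has_sum_on_scal _ (theta_term T 0 (m + 1)) _ _ H0)))].
    intros [j k] _; cbv beta; cbn [fst snd]; symmetry; apply laurent_term_step. }
assert (N : 1 - Cexp (IZR m * T) <> 0).
{ apply Cexp_neq_1; simpl; unfold Re in *.
  assert (IZR m <> 0)%R by now apply not_0_IZR.
  rewrite Rmult_0_l, Rminus_0_r; apply Rmult_integral_contrapositive; lra. }
transitivity ((P - Cexp (IZR m * T) * P) / (1 - Cexp (IZR m * T))).
- field; trivial.
- rewrite L; field; trivial.
Qed.

Lemma appell_mul_theta_series (T w : C) :
  annulus T w -> appell T w * theta_series T w = Csum_on full (laurent_term T 0).
Proof.
intros Hw; assert (HT : (Re T < 0)%R) by (destruct Hw; lra).
assert (AS := abs_summable_appell T w Hw); assert (AT := abs_summable_theta T w HT).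
assert (H := has_sum_on_prod _ _ _ _ AS AT (abs_summable_has_sum _ AS)
  (abs_summable_has_sum _ AT)).
assert (AP := abs_summable_prod _ _ AS AT).
(* Sort the product by the total exponent m of e^w. *)
pose (phi := fun q : Z * (Z * Z) => (snd q, (fst q - snd (snd q))%Z)).
assert (H' := has_sum_on_bij phi
  (fun q => (snd q + snd (fst q), fst q)%Z) _ _
  ltac:(intros [m [j k]]; unfold phi; simpl; f_equal; lia)
  ltac:(intros [[j k] a]; unfold phi; simpl; f_equal; lia) H).
assert (Row : forall m p, Cexp (IZR m * w) * laurent_term T m p
  = appell_term T w p * theta_term T w (m - snd p)).
{ intros m [j k]; unfold laurent_term, appell_term, theta_term; cbn [fst snd].
  match goal with |- ?a * (?q * (?s * ?b) * (?t * ?c)) = ?q * (?s * ?b') * (?t * ?c') =>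
    transitivity (q * s * t * (a * b * c)); [ring|
    transitivity (q * s * t * (b' * c')); [|ring]] end.
  rewrite <- !Cexp_plus; do 2 f_equal; Ceq. }
assert (AL : forall m, abs_summable (laurent_term T m)).
{ intros m.
  apply abs_summable_le with (c := Cmod (Cexp (- (IZR m * w))))
    (g := fun p => appell_term T w p * theta_term T w (m - snd p)).
  - intros p; rewrite <- Row, <- Cmod_mult; right; f_equal.
    rewrite Cmult_assoc, <- Cexp_plus.
    replace (- (IZR m * w) + IZR m * w) with (RtoC 0) by ring.
    rewrite Cexp_0; ring.
  - apply (abs_summable_comp (fun p : Z * Z => (p, (m - snd p)%Z)) _) in AP; trivial.
    intros p p' E; now injection E. }
assert (HL := has_sum_on_fubini _ (fun m => Cexp (IZR m * w)
  * Csum_on full (laurent_term T m)) _ H').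
apply (has_sum_on_unique full (fun m => Cexp (IZR m * w)
  * Csum_on full (laurent_term T m))).
- apply HL; intros m; unfold phi; cbn [fst snd].
  eapply has_sum_on_ext; [|exact (has_sum_on_scal _ (Cexp (IZR m * w)) _ _
    (abs_summable_has_sum _ (AL m)))].
  intros p _; apply Row.
- eapply has_sum_on_eq; [|apply (has_sum_on_single 0%Z)].
  + cbv beta; rewrite Cmult_0_l, Cexp_0; ring.
  + intros m Hm; rewrite (laurent_coef_0 T m _ HT Hm (abs_summable_has_sum _ (AL m))).
    ring.
Qed.

(** * The theta series has no zero in the annulus *)

(** In the product of the two series the terms with [a + b] odd cancel under the
    exchange of [a] and [b]. For [a = r + s], [b = r - s] the exponent
    [a(a-1)/2 + b(b-1)/2] equals [r(r-1) + s^2], which separates the variables. *)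
Lemma theta_series_duplication (T w : C) :
  (Re T < 0)%R ->
  theta_series T w * theta_series T (w + PI * Ci)
  = theta_series (2 * T) T * theta_series (2 * T) (2 * w).
Proof.
intros HT.
assert (HT2 : (Re (2 * T) < 0)%R) by (simpl; unfold Re in *; lra).
set (F := fun p : Z * Z => theta_term T w (fst p) * theta_term T (w + PI * Ci) (snd p)).
assert (AF : abs_summable F)
  by (apply abs_summable_prod; now apply abs_summable_theta).
assert (HF : has_sum_on full F (theta_series T w * theta_series T (w + PI * Ci))).
{ apply has_sum_on_prod; try now apply abs_summable_theta.
  all: now apply has_sum_theta. }
assert (EF : forall a b, F (a, b) = altsign a * Cexp
  ((IZR a * (IZR a - 1) / 2 + IZR b * (IZR b - 1) / 2)%R * T + (IZR a + IZR b)%R * w)).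
{ intros a b; unfold F, theta_term; cbn [fst snd].
  replace (IZR b * (w + PI * Ci)) with (PI * Ci * IZR b + IZR b * w) by ring.
  rewrite !Cexp_plus, Cexp_altsign.
  match goal with |- _ * (?x * ?y) * (altsign b * (?z * (altsign b * ?t))) = _ =>
    transitivity (altsign b * altsign b * (altsign a * (x * y * z * t))); [ring|] end.
  rewrite altsign_square, Cmult_1_l, <- !Cexp_plus; do 2 f_equal; Ceq. }
set (ev := fun p : Z * Z => Z.even (fst p + snd p)).
destruct (abs_summable_summable_on (fun p => ev p = true) F AF) as [e He].
destruct (abs_summable_summable_on (fun p => ev p = false) F AF) as [o Ho].
assert (Eo : o = 0).
{ apply C_eq_opp_0, (has_sum_on_unique (fun p => ev p = false) F); trivial.
  apply has_sum_on_eq with (- (1) * o); [ring|].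
  assert (Ho' : has_sum_on (fun p => ev p = false) (fun p => F (snd p, fst p)) o).
  { apply (has_sum_on_reindex (fun p => ev p = false) (fun p => ev p = false)
      (fun p : Z * Z => (snd p, fst p))); trivial.
    - intros [a b] [c d] _ _ E; simpl in E; congruence.
    - intros [a b]; unfold ev; simpl; now rewrite Z.add_comm.
    - intros [a b]; unfold ev; simpl; intros E; exists (b, a); simpl.
      now rewrite Z.add_comm. }
  eapply has_sum_on_ext; [|exact (has_sum_on_scal _ (- (1)) _ _ Ho')].
  intros [a b] Hab; cbn [fst snd]; rewrite !EF.
  assert (S : altsign b = - altsign a).
  { unfold ev in Hab; cbn [fst snd] in Hab.
    rewrite <- Z.negb_odd, Bool.negb_false_iff in Hab.
    apply Z.odd_spec in Hab; destruct Hab as [c Hc].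
    replace b with (- a + 2 * c + 1)%Z by lia.
    rewrite altsign_succ, altsign_plus, altsign_double, altsign_opp; ring. }
  rewrite S.
  replace ((IZR b * (IZR b - 1) / 2 + IZR a * (IZR a - 1) / 2)%R * T + (IZR b + IZR a)%R * w)
    with ((IZR a * (IZR a - 1) / 2 + IZR b * (IZR b - 1) / 2)%R * T + (IZR a + IZR b)%R * w)
    by Ceq.
  ring. }
assert (Ee : e = theta_series (2 * T) T * theta_series (2 * T) (2 * w)).
{ apply (has_sum_on_unique full
    (fun p : Z * Z => theta_term (2 * T) T (fst p) * theta_term (2 * T) (2 * w) (snd p))).
  2:{ apply has_sum_on_prod; try now apply abs_summable_theta.
      all: now apply has_sum_theta. }
  apply (has_sum_on_reindex full (fun p => ev p = true)
    (fun p : Z * Z => (snd p + fst p, snd p - fst p)%Z)) in He.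
  - eapply has_sum_on_ext; [|exact He]; intros [s r] _; cbn [fst snd].
    rewrite EF, altsign_plus; unfold theta_term.
    match goal with |- _ = _ * ?x * (_ * ?y) =>
      transitivity (altsign r * altsign s * (x * y)); [|ring] end.
    rewrite <- Cexp_plus; do 2 f_equal; Ceq.
  - intros [a b] [c d] _ _ E; simpl in E; injection E; intros; f_equal; lia.
  - intros [s r] _; unfold ev; simpl.
    apply Z.even_spec; exists r; lia.
  - intros [a b]; unfold ev; simpl; intros E; apply Z.even_spec in E.
    destruct E as [c Hc]; exists (a - c, c)%Z; split; [easy|]; simpl; f_equal; lia. }
rewrite <- Ee.
apply (has_sum_on_unique full F); trivial.
apply has_sum_on_eq with (e + o); [rewrite Eo; ring|].
eapply has_sum_on_ext; [|apply has_sum_on_plus;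
  [exact (has_sum_on_indicator _ ev _ _ (fun p => iff_refl _) He)
  |exact (has_sum_on_indicator _ (fun p => negb (ev p)) _ _
     (fun p => Bool.negb_true_iff (ev p)) Ho)]].
intros p _; cbv beta; destruct (ev p); simpl; ring.
Qed.

(** The terms of index [n <> 0] are bounded by [e^(-2 |n|)], so that their sum is
    less than the modulus 1 of the term of index 0. *)
Lemma theta_series_neq_0_far (T w : C) :
  (2 <= - Re w)%R -> (2 <= Re w - Re T)%R -> theta_series T w <> 0.
Proof.
intros H1 H2 HZ.
set (A := (- Re T)%R); set (B := (- Re w)%R).
assert (HT : (Re T < 0)%R) by lra.
set (r := exp (- (2))).
assert (Hr : (0 < r /\ 3 * r < 1)%R).
{ assert (P := exp_pos (- (2))); fold r in P; split; trivial.
  assert (Q := exp_ineq1 2 ltac:(lra)).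
  assert (Q' : (exp 2 * r = 1)%R)
    by (unfold r; rewrite <- exp_plus, <- exp_0; f_equal; ring).
  nra. }
assert (Bd : forall n, (Cmod (theta_term T w n) <= r ^ Z.abs_nat n)%R).
{ intros n; unfold r; rewrite Cmod_theta_term, exp_opp_Zabs.
  match goal with |- (exp ?a <= exp ?b)%R => assert (P : (a <= b)%R) end.
  { assert (Hn : n = 0%Z \/ (1 <= n)%Z \/ (n <= -1)%Z) by lia.
    replace (Re T) with (- A)%R by (unfold A; ring).
    replace (Re w) with (- B)%R in * by (unfold B; ring).
    replace (Re T) with (- A)%R in * by (unfold A; ring).
    destruct Hn as [->|[Hn|Hn]].
    - rewrite Rabs_R0; lra.
    - apply IZR_le in Hn; rewrite Rabs_pos_eq by lra.
      assert (0 <= IZR n * (IZR n - 1))%R by nra.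
      assert (0 <= A * (IZR n * (IZR n - 1)))%R by (apply Rmult_le_pos; lra).
      assert (2 * IZR n <= B * IZR n)%R by nra.
      nra.
    - apply IZR_le in Hn; rewrite Rabs_left by lra.
      destruct (Z.eq_dec n (-1)) as [->|Hn'].
      + lra.
      + assert (0 <= (IZR n + 1) * IZR n)%R by nra.
        assert (0 <= A * ((IZR n + 1) * IZR n))%R by (apply Rmult_le_pos; lra).
        assert (2 * - IZR n <= (A - B) * - IZR n)%R by nra.
        nra. }
  destruct P as [P|P]; [left; now apply exp_increasing | right; now rewrite P]. }
assert (H := has_sum_theta T w HT); rewrite HZ in H.
set (x := (2 * r / (1 - r))%R).
assert (Hx : (x < 1)%R).
{ unfold x; apply Rmult_lt_reg_r with (1 - r)%R; [lra|].
  replace (2 * r / (1 - r) * (1 - r))%R with (2 * r)%R by (field; lra); lra. }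
destruct (H (1 - x)%R ltac:(lra)) as [l0 [_ K]].
(* Split off the term of index 0, adding this index to l0 if it is missing. *)
destruct (NoDup_same_elements (filter (fun n => negb (n =? 0)%Z) l0)) as [l [N [I1 I2]]].
assert (N0 : ~ In 0%Z l).
{ intros Hin; apply I2, filter_In in Hin; destruct Hin; discriminate. }
specialize (K (0%Z :: l) (NoDup_cons _ N0 N) (Forall_full _)).
assert (I : incl l0 (0%Z :: l)).
{ intros n Hn; destruct (Z.eq_dec n 0) as [->|Hn0]; [now left|right].
  apply I1, filter_In; split; trivial; now apply Bool.negb_true_iff, Z.eqb_neq. }
specialize (K I).
change (Csum_list (theta_term T w) (0%Z :: l))
  with (theta_term T w 0 + Csum_list (theta_term T w) l) in K.
assert (E0 : theta_term T w 0 = 1).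
{ unfold theta_term, altsign; simpl powerRZ.
  replace ((0 * (0 - 1) / 2)%R * T + 0 * w) with (RtoC 0) by Ceq.
  rewrite Cexp_0; ring. }
rewrite E0 in K.
assert (G : (Cmod (Csum_list (theta_term T w) l) <= x)%R).
{ eapply Rle_trans; [apply Cmod_Csum_list|].
  eapply Rle_trans; [apply Rsum_list_le; intros n _; apply Bd|].
  apply Rsum_list_geom; trivial; lra. }
assert (X := Cmod_triangle (1 + Csum_list (theta_term T w) l - 0)
  (- Csum_list (theta_term T w) l)).
rewrite Cmod_opp in X.
replace (1 + Csum_list (theta_term T w) l - 0 + - Csum_list (theta_term T w) l)
  with (RtoC 1) in X by ring.
rewrite Cmod_1 in X; lra.
Qed.

(** Doubling [T] and [w] doubles the distance of [Re w] to the ends of the interval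
    [(Re T, 0)]. By [theta_series_duplication], [theta_series T w] is a factor of
    [theta_series (2 T) T * theta_series (2 T) (2 w)], and for both of these the
    distance is at least twice the original one. *)
Lemma theta_series_neq_0 (T w : C) : annulus T w -> theta_series T w <> 0.
Proof.
assert (P : forall n T w, (2 <= 2 ^ n * - Re w)%R -> (2 <= 2 ^ n * (Re w - Re T))%R ->
  theta_series T w <> 0).
{ clear T w; induction n as [|n IH]; intros T w H1 H2.
  - apply theta_series_neq_0_far; simpl in *; lra.
  - simpl pow in *.
    assert (Pn := pow_lt 2 n ltac:(lra)).
    assert (Rw : (Re w < 0)%R) by nra.
    assert (RT : (Re T < Re w)%R) by nra.
    assert (R2T : Re (2 * T) = (2 * Re T)%R) by (simpl; unfold Re; ring).
    assert (R2w : Re (2 * w) = (2 * Re w)%R) by (simpl; unfold Re; ring).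
    assert (N1 : theta_series (2 * T) T <> 0).
    { apply IH; rewrite ?R2T; nra. }
    assert (N2 : theta_series (2 * T) (2 * w) <> 0).
    { apply IH; rewrite ?R2T, ?R2w; lra. }
    intros Z; apply (Cmult_neq_0 _ _ N1 N2).
    rewrite <- theta_series_duplication, Z by lra; ring. }
intros [H1 H2].
(* The number n of duplications needed for 2^n times the distance to exceed 2. *)
destruct (Pow_x_infinity 2 ltac:(rewrite Rabs_pos_eq; lra)
  (2 / Rmin (- Re w) (Re w - Re T))) as [n Hn].
specialize (Hn n (le_n n)); rewrite Rabs_pos_eq in Hn by (apply pow_le; lra).
assert (Hd : (0 < Rmin (- Re w) (Re w - Re T))%R) by (apply Rmin_pos; lra).
assert (d1 := Rmin_l (- Re w) (Re w - Re T)).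
assert (d2 := Rmin_r (- Re w) (Re w - Re T)).
set (d := Rmin _ _) in *.
assert (Hn' : (2 <= 2 ^ n * d)%R).
{ apply Rge_le in Hn; apply (Rmult_le_compat_r d) in Hn; [|lra].
  replace (2 / d * d)%R with 2%R in Hn by (field; lra); trivial. }
assert (Pn := pow_lt 2 n ltac:(lra)).
apply (P n); nra.
Qed.

(** * The numerator as an Appell function *)

Definition nome_log (tau : C) : C := 2 * PI * Ci * tau.

(** For [k1 = k2 = 0] the translation vector [beta] vanishes. *)
Lemma num_PA_pt4 (m2 : Z) (tau z1 z2 t : C) :
  num_PA Plus 2 1 m2 0 0 (pt4 tau z1 z2 t)
  = num_L Plus 1 m2 (pt4 (2 * tau) z1 z2 (t / 2)).
Proof.
unfold num_PA; f_equal; apply wt_eq;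
  unfold pt4, pt, tau_of, z_of, t_of, beta_I, form, zvec, Lambda0, delta, alpha3,
    alpha1, alpha2; simpl; field;
  auto using CPI_neq_0, Ci_neq_0, C2_neq_0.
Qed.

Lemma r_theta_pt4 (tau z1 z2 t : C) :
  r_theta (pt4 tau z1 z2 t) = pt4 tau z2 z1 t.
Proof.
apply wt_eq; unfold r_theta, form, theta, pt4, pt, zvec, Lambda0, alpha3,
  alpha1, alpha2, delta; simpl; field; apply C2_neq_0.
Qed.

Lemma num_seed_pt4 (m2 j : Z) (tau z1 z2 t : C) :
  num_seed Plus 1 m2 (tr (- (IZR j *: theta))%wt (pt4 tau z1 z2 t))
  = Cexp (2 * PI * Ci * (t + (IZR j * IZR j)%R * tau - IZR j * (z1 - z2)
                         + (1 - IZR m2)%R * (z1 - IZR j * tau)))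
    / (1 + Cexp (2 * PI * Ci * (z1 - IZR j * tau))) ^ 2.
Proof.
unfold num_seed, expw; simpl sgnC.
assert (E1 : form (- alpha1)%wt (tr (- (IZR j *: theta))%wt (pt4 tau z1 z2 t))
  = 2 * PI * Ci * (z1 - IZR j * tau)).
{ unfold tr, form, theta, pt4, pt, zvec, Lambda0, alpha3, alpha1, alpha2, delta;
  simpl; field; apply C2_neq_0. }
assert (E2 : form (Lambda 1 m2 + rho)%wt (tr (- (IZR j *: theta))%wt (pt4 tau z1 z2 t))
  = 2 * PI * Ci * (t + (IZR j * IZR j)%R * tau - IZR j * (z1 - z2)
                         + (1 - IZR m2)%R * (z1 - IZR j * tau))).
{ rewrite RtoC_minus, RtoC_mult.
  unfold Lambda, rho, tr, form, theta, pt4, pt, zvec, Lambda0, alpha3, alpha1, alpha2, delta;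
  simpl; field; apply C2_neq_0. }
unfold alpha3 at 1; rewrite E1, E2; f_equal; ring.
Qed.

(** Up to the factor [e^(2 pi i t)], the seed with [m2 = 1] at a translated point,
    where [u = - e^(w + n T)]; [seed_term_u] is the one with [m2 = 0]. *)
Definition seed_term (T w : C) (n : Z) : C :=
  Cexp ((IZR n * (IZR n + 1) / 2)%R * T) / (1 - Cexp (w + IZR n * T)) ^ 2.

Definition seed_term_u (T w : C) (n : Z) : C :=
  - Cexp (w + IZR n * T) * seed_term T w n.

Lemma denominator_neq_0 (T w : C) (c : R) (n : Z) :
  pole_distance T w c -> 1 - Cexp (w + IZR n * T) <> 0.
Proof. intros [Hc Hb] E; specialize (Hb n); rewrite E, Cmod_0 in Hb; lra. Qed.

(** The identity [u/(1+u)^2 + 1/(1+u)^2 = 1/(1+u)]. *)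
Lemma seed_terms_sum (T w : C) (c : R) (n : Z) :
  pole_distance T w c ->
  seed_term_u T w n + seed_term T w n = altsign n * appell_quot T w n.
Proof.
intros Hp; unfold seed_term_u, seed_term, appell_quot.
assert (N := denominator_neq_0 T w c n Hp).
set (V := 1 - Cexp (w + IZR n * T)) in *.
replace (Cexp (w + IZR n * T)) with (1 - V) by (unfold V; ring).
set (X := Cexp _).
transitivity (X / V); [field; trivial|].
transitivity (altsign n * altsign n * (X / V)); [|field; trivial].
rewrite altsign_square; ring.
Qed.

Lemma abs_summable_appell_quot (T w : C) (c : R) :
  (Re T < 0)%R -> pole_distance T w c -> abs_summable (appell_quot T w).
Proof.
intros HT Hp; assert (Hp' := Hp); destruct Hp' as [Hc Hb].
apply abs_summable_le with (c := (/ c)%R) (g := theta_term T T);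
  [|now apply abs_summable_theta].
intros n; unfold appell_quot; rewrite theta_term_shift.
rewrite Cmod_div by now apply denominator_neq_0 with c.
rewrite !Cmod_mult, !Cmod_altsign, !Rmult_1_l.
unfold Rdiv; rewrite Rmult_comm; apply Rmult_le_compat_r; [apply Cmod_ge_0|].
apply Rinv_le_contravar; trivial.
Qed.

Lemma abs_summable_seed_term (T w : C) (c : R) :
  (Re T < 0)%R -> pole_distance T w c -> abs_summable (seed_term T w).
Proof.
intros HT Hp; assert (Hp' := Hp); destruct Hp' as [Hc Hb].
apply abs_summable_le with (c := (/ c)%R) (g := appell_quot T w);
  [|now apply abs_summable_appell_quot with c].
intros n; unfold seed_term, appell_quot.
assert (N := denominator_neq_0 T w c n Hp).
specialize (Hb n).
set (V := 1 - Cexp (w + IZR n * T)) in *; set (X := Cexp _).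
replace (X / V ^ 2) with (altsign n * altsign n * (X / V ^ 2))
  by (rewrite altsign_square; ring).
replace (altsign n * altsign n * (X / V ^ 2)) with (altsign n * (/ V * (altsign n * X / V)))
  by (field; trivial).
rewrite Cmod_mult, Cmod_altsign, Rmult_1_l, Cmod_mult.
rewrite Cmod_inv by trivial.
apply Rmult_le_compat_r; [apply Cmod_ge_0|].
apply Rinv_le_contravar; trivial.
Qed.

Lemma abs_summable_seed_term_u (T w : C) (c : R) :
  (Re T < 0)%R -> pole_distance T w c -> abs_summable (seed_term_u T w).
Proof.
intros HT Hp.
apply abs_summable_le with (c := 1%R)
  (g := fun n => altsign n * appell_quot T w n + - (1) * seed_term T w n).
- intros n; rewrite Rmult_1_l; right; f_equal; rewrite <- (seed_terms_sum T w c n Hp); ring.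
- apply abs_summable_plus; [|now apply abs_summable_scal, abs_summable_seed_term with c].
  apply abs_summable_le with (c := 1%R) (g := appell_quot T w).
  + intros n; rewrite Cmod_mult, Cmod_altsign; lra.
  + now apply abs_summable_appell_quot with c.
Qed.

(** With [z1 - z2 = tau] the translation by [t_(j theta)] at [2 tau] yields the exponent
    [2 j^2 - j = n(n+1)/2] at [n = -2 j]; on the reflected side it is
    [2 j^2 + j = n(n+1)/2] at [n = -2 j - 1]. *)
Lemma num_seed_even (tau z1 t : C) (j : Z) :
  let T := nome_log tau in
  let w := 2 * PI * Ci * z1 + PI * Ci in
  let h := pt4 (2 * tau) z1 (z1 - tau) t in
  num_seed Plus 1 0 (tr (- (IZR j *: theta))%wt h)
    = Cexp (2 * PI * Ci * t) * seed_term_u T w (-2 * j) /\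
  num_seed Plus 1 1 (tr (- (IZR j *: theta))%wt h)
    = Cexp (2 * PI * Ci * t) * seed_term T w (-2 * j).
Proof.
intros T w h; unfold h; rewrite !num_seed_pt4; unfold seed_term_u, seed_term.
set (U := 2 * PI * Ci * (z1 - IZR j * (2 * tau))).
assert (EU : w + IZR (-2 * j) * T = U + PI * Ci).
{ unfold w, T, U, nome_log; rewrite mult_IZR, RtoC_mult; ring. }
rewrite EU, Cexp_half_shift.
replace (1 - - Cexp U) with (1 + Cexp U) by ring.
replace (- - Cexp U) with (Cexp U) by ring.
unfold Cdiv; rewrite !Cmult_assoc, <- !Cexp_plus.
split; do 2 f_equal; unfold U, T, nome_log; rewrite ?mult_IZR;
  repeat rewrite ?RtoC_minus, ?RtoC_mult, ?RtoC_div, ?RtoC_plus; try lra; field;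
  apply C2_neq_0.
Qed.

Lemma num_seed_odd (tau z1 t : C) (j : Z) :
  let T := nome_log tau in
  let w := 2 * PI * Ci * z1 + PI * Ci in
  let h := pt4 (2 * tau) (z1 - tau) z1 t in
  num_seed Plus 1 0 (tr (- (IZR j *: theta))%wt h)
    = Cexp (2 * PI * Ci * t) * seed_term_u T w (-2 * j - 1) /\
  num_seed Plus 1 1 (tr (- (IZR j *: theta))%wt h)
    = Cexp (2 * PI * Ci * t) * seed_term T w (-2 * j - 1).
Proof.
intros T w h; unfold h; rewrite !num_seed_pt4; unfold seed_term_u, seed_term.
set (U := 2 * PI * Ci * (z1 - tau - IZR j * (2 * tau))).
assert (EU : w + IZR (-2 * j - 1) * T = U + PI * Ci).
{ unfold w, T, U, nome_log; rewrite minus_IZR, mult_IZR, RtoC_minus, RtoC_mult; ring. }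
rewrite EU, Cexp_half_shift.
replace (1 - - Cexp U) with (1 + Cexp U) by ring.
replace (- - Cexp U) with (Cexp U) by ring.
unfold Cdiv; rewrite !Cmult_assoc, <- !Cexp_plus.
split; do 2 f_equal; unfold U, T, nome_log; rewrite ?minus_IZR, ?mult_IZR;
  repeat rewrite ?RtoC_minus, ?RtoC_mult, ?RtoC_div, ?RtoC_plus; try lra; field;
  apply C2_neq_0.
Qed.

(** The translates of the seeds give the even terms of the Appell function and
    their [r_theta]-reflections the odd ones; the minus sign in front of the
    reflection is the sign [(-1)^n]. *)
Lemma num_ddL_eq (tau z1 z2 t : C) (c : R) (s : C) :
  let T := nome_log tau in
  let w := 2 * PI * Ci * z1 + PI * Ci in
  (Re T < 0)%R -> z2 = z1 - tau -> pole_distance T w c ->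
  has_sum_on full (appell_quot T w) s ->
  num_ddL Plus 2 1 0 0 0 (pt4 tau z1 z2 t) = Cexp (PI * Ci * t) * s.
Proof.
intros T w HT -> Hp Hs.
unfold num_ddL; rewrite !num_PA_pt4; unfold num_L; rewrite !r_theta_pt4.
simpl sgnC; simpl (0 + 1)%Z.
set (K := Cexp (2 * PI * Ci * (t / 2))).
assert (AU := abs_summable_seed_term_u T w c HT Hp).
assert (AV := abs_summable_seed_term T w c HT Hp).
assert (AE : forall f : Z -> C, abs_summable f -> has_sum_on full
  (fun j => f (-2 * j)%Z) (Csum_on full (fun j => f (-2 * j)%Z))).
{ intros f Hf; apply abs_summable_has_sum.
  apply (abs_summable_comp (fun j => -2 * j)%Z f); trivial; intros; lia. }
assert (AO : forall f : Z -> C, abs_summable f -> has_sum_on full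
  (fun j => f (-2 * j - 1)%Z) (Csum_on full (fun j => f (-2 * j - 1)%Z))).
{ intros f Hf; apply abs_summable_has_sum.
  apply (abs_summable_comp (fun j => -2 * j - 1)%Z f); trivial; intros; lia. }
assert (U0 := AE _ AU); assert (U1 := AO _ AU).
assert (V0 := AE _ AV); assert (V1 := AO _ AV).
set (u0 := Csum_on _ _) in U0; set (u1 := Csum_on _ _) in U1.
set (v0 := Csum_on _ _) in V0; set (v1 := Csum_on _ _) in V1.
assert (F0 : num_F Plus 1 0 (pt4 (2 * tau) z1 (z1 - tau) (t / 2)) = K * u0).
{ apply Csum_on_correct; eapply has_sum_on_ext; [|exact (has_sum_on_scal _ K _ _ U0)].
  intros j _; exact (eq_sym (proj1 (num_seed_even tau z1 (t / 2) j))). }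
assert (F1 : num_F Plus 1 1 (pt4 (2 * tau) z1 (z1 - tau) (t / 2)) = K * v0).
{ apply Csum_on_correct; eapply has_sum_on_ext; [|exact (has_sum_on_scal _ K _ _ V0)].
  intros j _; exact (eq_sym (proj2 (num_seed_even tau z1 (t / 2) j))). }
assert (G0 : num_F Plus 1 0 (pt4 (2 * tau) (z1 - tau) z1 (t / 2)) = K * u1).
{ apply Csum_on_correct; eapply has_sum_on_ext; [|exact (has_sum_on_scal _ K _ _ U1)].
  intros j _; exact (eq_sym (proj1 (num_seed_odd tau z1 (t / 2) j))). }
assert (G1 : num_F Plus 1 1 (pt4 (2 * tau) (z1 - tau) z1 (t / 2)) = K * v1).
{ apply Csum_on_correct; eapply has_sum_on_ext; [|exact (has_sum_on_scal _ K _ _ V1)].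
  intros j _; exact (eq_sym (proj2 (num_seed_odd tau z1 (t / 2) j))). }
rewrite F0, F1, G0, G1.
replace (Cexp (PI * Ci * t)) with K by (unfold K; f_equal; field; apply C2_neq_0).
assert (Es : s = (u0 + v0) + - (1) * (u1 + v1)); [|rewrite Es; ring].
apply (has_sum_on_unique _ _ _ _ Hs).
apply has_sum_even_odd.
- now apply abs_summable_appell_quot with c.
- eapply has_sum_on_ext; [|exact (has_sum_on_plus _ _ _ _ _ U0 V0)].
  intros j _; cbv beta; rewrite (seed_terms_sum T w c _ Hp).
  replace (-2 * j)%Z with (2 * - j)%Z by lia; rewrite altsign_double; ring.
- eapply has_sum_on_ext; [|exact (has_sum_on_scal _ (- (1)) _ _
    (has_sum_on_plus _ _ _ _ _ U1 V1))].
  intros j _; cbv beta; rewrite (seed_terms_sum T w c _ Hp).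
  replace (-2 * j - 1)%Z with (2 * (- j - 1) + 1)%Z by lia.
  rewrite altsign_succ, altsign_double; ring.
Qed.

(** * The indefinite theta series as Fourier coefficients *)

(** Passes from the difference of two sums over quadrants to a single sum over
    [Z x Z], to which reindexing and Fubini apply. *)
Lemma has_sum_indefinite (g : Z * Z -> C) :
  abs_summable (fun p => quadrant_sign p * g p) ->
  indefinite_summable g /\
  has_sum_on full (fun p => quadrant_sign p * g p) (indefinite_sum g).
Proof.
intros Ha.
destruct (abs_summable_summable_on both_nonneg _ Ha) as [a Sa].
destruct (abs_summable_summable_on both_neg _ Ha) as [b Sb].
assert (Ga : has_sum_on both_nonneg g a).
{ eapply has_sum_on_ext; [|exact Sa]; intros [j k] [H1 H2]; simpl in *.
  unfold quadrant_sign; simpl.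
  destruct (Z.leb_spec 0 j), (Z.leb_spec 0 k); try lia; simpl; ring. }
assert (Gb : has_sum_on both_neg g (- (1) * b)).
{ eapply has_sum_on_ext; [|exact (has_sum_on_scal _ (- (1)) _ _ Sb)].
  intros [j k] [H1 H2]; simpl in *; unfold quadrant_sign; simpl.
  destruct (Z.leb_spec 0 j), (Z.ltb_spec j 0), (Z.ltb_spec k 0); try lia; simpl; ring. }
split; [split; eexists; eassumption|].
unfold indefinite_sum; rewrite (Csum_on_correct _ _ _ Ga), (Csum_on_correct _ _ _ Gb).
assert (Pa : forall p, ((0 <=? fst p) && (0 <=? snd p))%bool%Z = true <-> both_nonneg p).
{ intros p; unfold both_nonneg; rewrite Bool.andb_true_iff, !Z.leb_le; tauto. }
assert (Pb : forall p, ((fst p <? 0) && (snd p <? 0))%bool%Z = true <-> both_neg p).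
{ intros p; unfold both_neg; rewrite Bool.andb_true_iff, !Z.ltb_lt; tauto. }
eapply has_sum_on_ext; [|exact (has_sum_on_minus _ _ _ _ _
  (has_sum_on_indicator _ _ _ _ Pa Ga) (has_sum_on_indicator _ _ _ _ Pb Gb))].
intros [j k] _; unfold quadrant_sign; cbn [fst snd].
destruct (Z.leb_spec 0 j), (Z.leb_spec 0 k), (Z.ltb_spec j 0), (Z.ltb_spec k 0);
  try lia; simpl; ring.
Qed.

Definition gauss_term (tau z : C) (c : R) (n : Z) : C :=
  Cexp (2 * PI * Ci * IZR n * z) * qpow tau (1 / 2 * (IZR n + c) ^ 2).

Lemma abs_summable_gauss (tau z : C) (c : R) :
  (Re (nome_log tau) < 0)%R -> abs_summable (gauss_term tau z c).
Proof.
intros HT.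
apply abs_summable_le with (c := Cmod (qpow tau (c ^ 2 / 2)))
  (g := theta_term (nome_log tau)
    (2 * PI * Ci * z + (c + 1 / 2)%R * nome_log tau)).
- intros n; rewrite <- Cmod_mult; right.
  unfold theta_term; rewrite !Cmod_mult, Cmod_altsign, Rmult_1_l.
  unfold gauss_term, qpow; rewrite <- !Cmod_mult, <- !Cexp_plus; do 2 f_equal.
  unfold nome_log; Ceq.
- now apply abs_summable_theta.
Qed.

(** Multiply [gauss_term] by the double series of the Appell function at
    [y = x^(-2)], where [x = e^(2 pi i z)], and shift [n] by [2 k]: the powers [x^(2k)]
    cancel, and the row of index [n] is [x^n] times the indefinite theta series. *)
Lemma has_sum_fourier (tau z : C) (c : R) (nu : Z -> R) (g : C) :
  (Re (nome_log tau) < 0)%R -> annulus (nome_log tau) (- (2) * (2 * PI * Ci * z)) ->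
  (forall n, nu n = IZR n + c)%R ->
  has_sum_on full (gauss_term tau z c) g ->
  (forall n, indefinite_summable (ddH_term tau (nu n))) /\
  has_sum_on allZ (fun n : Z =>
    Cexp (2 * PI * Ci * IZR n * z) * indefinite_sum (ddH_term tau (nu n)))
    (g * appell (nome_log tau) (- (2) * (2 * PI * Ci * z))).
Proof.
intros HT Hw Hnu Hg.
set (T := nome_log tau) in *; set (w := - (2) * (2 * PI * Ci * z)) in *.
assert (AG := abs_summable_gauss tau z c HT); assert (AA := abs_summable_appell T w Hw).
assert (AP := abs_summable_prod _ _ AG AA).
assert (HP := has_sum_on_prod _ _ _ _ AG AA Hg (abs_summable_has_sum _ AA)).
set (F := fun p : Z * (Z * Z) => gauss_term tau z c (fst p) * appell_term T w (snd p)) in *.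
pose (phi := fun p : Z * (Z * Z) => ((fst p + 2 * snd (snd p))%Z, snd p)).
pose (psi := fun p : Z * (Z * Z) => ((fst p - 2 * snd (snd p))%Z, snd p)).
assert (HF : has_sum_on full (fun p => F (phi p)) (g * appell T w)).
{ apply (has_sum_on_bij phi psi); trivial;
    intros [n [j k]]; unfold phi, psi; simpl; f_equal; lia. }
assert (EF : forall n p, F (phi (n, p))
  = Cexp (2 * PI * Ci * IZR n * z) * (quadrant_sign p * ddH_term tau (nu n) p)).
{ intros n [j k]; unfold F, phi, gauss_term, appell_term, ddH_term, qpow; cbn [fst snd].
  fold (altsign j); rewrite Hnu.
  match goal with |- ?a * ?b * (?q * (?s * ?x)) = ?a' * (?q * (?s * ?b')) =>
    transitivity (q * s * (a * b * x)); [ring|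
    transitivity (q * s * (a' * b')); [|ring]] end.
  rewrite <- !Cexp_plus; do 2 f_equal; unfold T, w, nome_log; Ceq. }
assert (AR : forall n, abs_summable (fun p => quadrant_sign p * ddH_term tau (nu n) p)).
{ intros n.
  apply abs_summable_le with (c := Cmod (Cexp (- (2 * PI * Ci * IZR n * z))))
    (g := fun p => F (phi (n, p))).
  - intros p; rewrite EF, <- Cmod_mult; right; f_equal.
    rewrite (Cmult_assoc (Cexp _)), <- Cexp_plus.
    replace (- (2 * PI * Ci * IZR n * z) + 2 * PI * Ci * IZR n * z)
      with (RtoC 0) by ring.
    rewrite Cexp_0; ring.
  - apply (abs_summable_comp (fun p => phi (n, p)) F); trivial.
    intros [j k] [j' k'] E; injection E; intros; subst; trivial. }
split.
- intros n; now apply has_sum_indefinite.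
- apply (has_sum_on_fubini _ _ _ HF); intros n.
  eapply has_sum_on_ext; [|exact (has_sum_on_scal _ (Cexp (2 * PI * Ci * IZR n * z)) _ _
    (proj2 (has_sum_indefinite _ (AR n))))].
  intros p _; symmetry; apply EF.
Qed.

(** * The Mumford theta functions *)

Lemma has_sum_gauss_0 (tau z : C) :
  (Re (nome_log tau) < 0)%R ->
  has_sum_on full (gauss_term tau z 0)
    (theta_series (nome_log tau) (2 * PI * Ci * z + nome_log tau / 2 + PI * Ci)).
Proof.
intros HT; eapply has_sum_on_ext; [|exact (has_sum_theta _ _ HT)].
intros n _; cbv beta; rewrite theta_term_antiperiod; unfold gauss_term, qpow.
rewrite <- Cexp_plus; f_equal; unfold nome_log; Ceq.
Qed.

(** At [m = - n] the exponent [(n + 1/2)^2/2] becomes [m(m-1)/2 + 1/8]. *)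
Lemma has_sum_gauss_half (tau z : C) :
  (Re (nome_log tau) < 0)%R ->
  has_sum_on full (gauss_term tau z (1 / 2))
    (Cexp (nome_log tau / 8)
     * theta_series (nome_log tau) (- (2 * PI * Ci * z) + PI * Ci)).
Proof.
intros HT; eapply has_sum_on_ext;
  [|exact (has_sum_on_scal _ _ _ _ (has_sum_theta_opp _ _ HT))].
intros n _; cbv beta; rewrite theta_term_antiperiod; unfold gauss_term, qpow.
rewrite <- !Cexp_plus; f_equal; unfold nome_log; Ceq.
Qed.

Lemma vartheta_00 (tau z : C) :
  (Re (nome_log tau) < 0)%R ->
  vartheta 0 0 tau z
  = theta_series (nome_log tau) (2 * PI * Ci * z + nome_log tau / 2 + PI * Ci).
Proof.
intros HT; apply Csum_on_correct; eapply has_sum_on_ext;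
  [|exact (has_sum_gauss_0 tau z HT)].
intros n _; cbv beta; unfold gauss_term, qpow; rewrite <- Cexp_plus; f_equal; Ceq.
Qed.

Lemma vartheta_10 (tau z : C) :
  (Re (nome_log tau) < 0)%R ->
  vartheta 1 0 tau z
  = Cexp (PI * Ci * z) * (Cexp (nome_log tau / 8)
     * theta_series (nome_log tau) (- (2 * PI * Ci * z) + PI * Ci)).
Proof.
intros HT; apply Csum_on_correct; eapply has_sum_on_ext;
  [|exact (has_sum_on_scal _ (Cexp (PI * Ci * z)) _ _ (has_sum_gauss_half tau z HT))].
intros n _; cbv beta; unfold gauss_term, qpow; rewrite <- !Cexp_plus; f_equal; Ceq.
Qed.

Lemma vartheta_11 (tau z : C) :
  (Re (nome_log tau) < 0)%R ->
  vartheta 1 1 tau (2 * z)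
  = Ci * Cexp (nome_log tau / 8) * Cexp (2 * PI * Ci * z)
    * theta_series (nome_log tau) (- (2) * (2 * PI * Ci * z)).
Proof.
intros HT; apply Csum_on_correct; eapply has_sum_on_ext;
  [|exact (has_sum_on_scal _ _ _ _ (has_sum_theta_opp _ _ HT))].
intros n _; cbv beta; unfold theta_term; rewrite altsign_opp.
match goal with |- Ci * ?a * ?b * (_ * ?d) = _ =>
  transitivity (Cexp (PI * Ci / 2) * a * b * (altsign n * d));
    [now rewrite Cexp_half_PI|] end.
rewrite <- Cexp_altsign, <- !Cexp_plus; f_equal; unfold nome_log; Ceq.
Qed.

(** * The character formulas *)

Theorem corollary5p3 (tau z : C)
  (Htau : (0 < Im tau)%R)
  (Hz : (- (1 / 2) * Im tau < Im z < 0)%R) :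
  ( (forall n : Z, indefinite_summable (ddH_term tau (IZR n))) /\
    summable_on allZ (fun n : Z =>
      Cexp (2 * PI * Ci * IZR n * z) * indefinite_sum (ddH_term tau (IZR n))) /\
    N4_ch_ddH 2 1 0 0 0 tau z
    = Cexp (- (2) * PI * Ci * z) / dedekind_eta tau ^ 3
      * Csum_on allZ (fun n : Z =>
          Cexp (2 * PI * Ci * IZR n * z) * indefinite_sum (ddH_term tau (IZR n))) )
  /\
  ( (forall n : Z, indefinite_summable (ddH_term tau (IZR n + 1 / 2))) /\
    summable_on allZ (fun n : Z =>
      Cexp (2 * PI * Ci * IZR n * z)
      * indefinite_sum (ddH_term tau (IZR n + 1 / 2))) /\
    N4_ch_ddH_tw 2 1 0 0 0 tau z
    = Cexp (- PI * Ci * z) / dedekind_eta tau ^ 3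
      * Csum_on allZ (fun n : Z =>
          Cexp (2 * PI * Ci * IZR n * z)
          * indefinite_sum (ddH_term tau (IZR n + 1 / 2))) ).
Proof.
set (T := nome_log tau); set (Z := 2 * PI * Ci * z).
assert (RT : Re T = (- (2 * PI * Im tau))%R)
  by (unfold T, nome_log; simpl; unfold Re, Im; ring).
assert (RZ : Re Z = (- (2 * PI * Im z))%R)
  by (unfold Z; simpl; unfold Re, Im; ring).
pose proof PI_RGT_0 as HPI.
assert (P1 : (0 < PI * Im tau)%R) by nra.
assert (P2 : (PI * Im z < 0)%R) by nra.
assert (P3 : (- (PI * Im tau) < 2 * (PI * Im z))%R) by nra.
assert (HT : (Re T < 0)%R) by lra.
(* The logarithms of - x q^(1/2), of x^(-2) and of - 1/x. *)
set (w1 := Z + T / 2 + PI * Ci); set (w2 := - (2) * Z); set (w3 := - Z + PI * Ci).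
assert (R1 : Re w1 = (Re Z + Re T / 2)%R)
  by (unfold w1; simpl; unfold Re, Im; field).
assert (R2 : Re w2 = (- 2 * Re Z)%R) by (unfold w2; simpl; unfold Re, Im; ring).
assert (R3 : Re w3 = (- Re Z)%R) by (unfold w3; simpl; unfold Re, Im; ring).
assert (A1 : annulus T w1) by (unfold annulus; lra).
assert (A2 : annulus T w2) by (unfold annulus; lra).
assert (A3 : annulus T w3) by (unfold annulus; lra).
assert (Q1 := appell_mul_theta_series T w1 A1); assert (N1 := theta_series_neq_0 T w1 A1).
assert (Q2 := appell_mul_theta_series T w2 A2); assert (N2 := theta_series_neq_0 T w2 A2).
assert (Q3 := appell_mul_theta_series T w3 A3); assert (N3 := theta_series_neq_0 T w3 A3).
set (P := Csum_on _ _) in Q1, Q2, Q3.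
set (E8 := Cexp (T / 8)).
assert (V11 : vartheta 1 1 tau (2 * z) = Ci * E8 * Cexp Z * theta_series T w2)
  by now apply vartheta_11.
assert (NE8 : E8 <> 0) by apply Cexp_neq_0.
assert (NZ : Cexp Z <> 0) by apply Cexp_neq_0.
assert (Ci2 : Ci * Ci = - (1)) by Ceq.
split.
- destruct (has_sum_fourier tau z 0 IZR (theta_series T w1) HT A2
    (fun n => eq_sym (Rplus_0_r _)) (has_sum_gauss_0 tau z HT)) as [S1 S2].
  fold T Z w2 in S2.
  split; [exact S1|]; split; [eexists; exact S2|].
  rewrite (Csum_on_correct _ _ _ S2).
  destruct (appell_denominator_bound T w1 A1) as [c Hp].
  assert (Ew : 2 * PI * Ci * (z + tau / 2) + PI * Ci = w1)
    by (unfold w1, T, Z, nome_log; field; apply C2_neq_0).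
  assert (L := num_ddL_eq tau (z + tau / 2) (z - tau / 2) (tau / 4) c (appell T w1) HT
    ltac:(field; apply C2_neq_0)).
  fold T in L; rewrite Ew in L.
  specialize (L Hp (has_sum_appell_quot T w1 A1)).
  unfold N4_ch_ddH, N4_R, N4_pt; rewrite L, V11, vartheta_00 by exact HT.
  fold T Z w1.
  replace (Cexp (PI * Ci * (tau / 4))) with E8
    by (unfold E8, T, nome_log; f_equal; Ceq).
  replace (Cexp (- (2) * PI * Ci * z)) with (/ Cexp Z)
    by (rewrite <- Cexp_opp; f_equal; unfold Z; ring).
  set (h := dedekind_eta tau ^ 3).
  destruct (Classical_Prop.classic (h = 0)) as [H0|H0].
  { rewrite H0; unfold Cdiv; rewrite !Cmult_0_l, !Cmult_0_r, Cinv_0; ring. }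
  replace (- Ci * (h * (Ci * E8 * Cexp Z * theta_series T w2) / theta_series T w1 ^ 2))
    with (- (Ci * Ci) * (h * (E8 * Cexp Z * theta_series T w2) / theta_series T w1 ^ 2))
    by (field; trivial).
  rewrite Ci2.
  (* Bring out the product of the Appell function and the theta series: its value P
     is the same at w1 and w2 (and at w3, for the twisted character). *)
  transitivity (theta_series T w1 * (appell T w1 * theta_series T w1)
                / (h * Cexp Z * theta_series T w2)).
  { field; repeat split; trivial. }
  rewrite Q1, <- Q2; field; repeat split; trivial.
- destruct (has_sum_fourier tau z (1 / 2) (fun n => IZR n + 1 / 2)%R _ HT A2
    (fun n => eq_refl) (has_sum_gauss_half tau z HT)) as [S1 S2].
  fold T Z w2 w3 E8 in S2.
  split; [exact S1|]; split; [eexists; exact S2|].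
  rewrite (Csum_on_correct _ _ _ S2).
  destruct (appell_denominator_bound T w3 A3) as [c [Hc Hb]].
  assert (Ew : 2 * PI * Ci * (- (z - tau / 2) + tau / 2) + PI * Ci = w3 + T)
    by (unfold w3, T, Z, nome_log; field; apply C2_neq_0).
  assert (Hp' : pole_distance T (w3 + T) c).
  { split; [exact Hc|]; intros n.
    replace (w3 + T + IZR n * T) with (w3 + IZR (n + 1) * T) by Ceq.
    apply Hb. }
  assert (L := num_ddL_eq tau (- (z - tau / 2) + tau / 2) (- (z + tau / 2) + tau / 2)
    (tau / 4 + ((z + tau / 2) + (z - tau / 2)) / 2 - tau / 4) c
    (- Cexp w3 * appell T w3) HT
    ltac:(field; apply C2_neq_0)).
  fold T in L; rewrite Ew in L.
  specialize (L Hp' (has_sum_appell_quot_shift T w3 A3)).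
  unfold N4_ch_ddH_tw, twist, N4_R_tw, N4_pt.
  rewrite w0_pt4, L, V11, vartheta_10 by exact HT.
  fold T Z w3 E8.
  replace (PI * Ci * (tau / 4 + (z + tau / 2 + (z - tau / 2)) / 2 - tau / 4))
    with (PI * Ci * z) by (field; auto using C4_neq_0, C2_neq_0).
  set (X := Cexp (PI * Ci * z)).
  assert (NX : X <> 0) by apply Cexp_neq_0.
  assert (EX : Cexp Z = X * X) by (unfold X, Z; rewrite <- Cexp_plus; f_equal; ring).
  replace (Cexp w3) with (- / (X * X))
    by (rewrite <- EX; unfold w3; rewrite Cexp_half_shift, Cexp_opp; trivial).
  replace (Cexp (- PI * Ci * z)) with (/ X)
    by (unfold X; rewrite <- Cexp_opp; f_equal; ring).
  rewrite EX.
  set (h := dedekind_eta tau ^ 3).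
  destruct (Classical_Prop.classic (h = 0)) as [H0|H0].
  { rewrite H0; unfold Cdiv; rewrite !Cmult_0_l, !Cmult_0_r, Cinv_0; ring. }
  replace (- Ci * (h * (Ci * E8 * (X * X) * theta_series T w2)
                   / (X * (E8 * theta_series T w3)) ^ 2))
    with (- (Ci * Ci) * (h * theta_series T w2 / (E8 * theta_series T w3 ^ 2)))
    by (field; repeat split; trivial).
  rewrite Ci2.
  transitivity (E8 * theta_series T w3 * (appell T w3 * theta_series T w3)
                / (h * X * theta_series T w2)).
  { field; repeat split; trivial. }
  rewrite Q3, <- Q2; field; repeat split; trivial.
Qed.
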